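(* Let $f:M\to\mathbb R^{m+1}$, $m=\dim M\ge2$, be a locally convex improper affine sphere with induced statistical structure $(g,\nabla)$ on $M$, and equip $(\mathbb R^{m+1},D)$, where $D$ is the standard flat affine connection, with the Euclidean metric $g_0$ (a Riemannian metric with $Dg_0=0$). Then the map $f:(M,g,\nabla)\to(\mathbb R^{m+1},g_0,D)$ is a stable statistical biharmonic map.
   Context: All objects are smooth; $M$ is orientable. Affine geometry: for an immersion $f:M^m\to\mathbb R^{m+1}$ with transversal vector field $\xi$ which is equiaffine ($D_X\xi$ is tangent), the Gauss and Weingarten formulas $D_Xf_*Y=f_*\nabla_XY+g(X,Y)\xi$ and $D_X\xi=-f_*(SX)$ define the induced connection $\nabla$, the affine fundamental form $g$ and the shape operator $S$; $\{f,\xi\}$ is locally (strongly) convex if $g$ is positive definite, in which case $(g,\nabla)$ is the induced statistical structure. A Blaschke immersion is one where moreover $\xi$ is the affine normal: the volume form $\det(f_*X_1,\dots,f_*X_m,\xi)$ coincides (up to orientation) with the volume form of $g$; then $T^M=0$ (see below). A locally convex improper affine sphere is a locally convex Blaschke immersion with $S=0$. A statistical manifold $(M,g,\nabla)$ is a Riemannian manifold with a torsion-free affine connection such that $(\nabla_Xg)(Y,Z)=(\nabla_Yg)(X,Z)$. $\nabla^g$ is the Levi-Civita connection. The difference tensor is $K_XY=K(X,Y)=\nabla_XY-\nabla^g_XY$, the Tchebychev vector field is $T=\mathrm{tr}_gK$. The conjugate connection $\overline\nabla$ is defined by $Xg(Y,Z)=g(\nabla_XY,Z)+g(Y,\overline\nabla_XZ)$.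 Curvature: $R(X,Y)Z=\nabla_X\nabla_YZ-\nabla_Y\nabla_XZ-\nabla_{[X,Y]}Z$; $\overline R$ is the curvature of $\overline\nabla$. The tensor $L$ is defined by $g(L(Z,W)X,Y)=g(R(X,Y)Z,W)$, and $\bar L$ is the same tensor built from $\overline R$. Superscripts $M,N$ indicate the manifold. For a smooth map $u:(M,g,\nabla^M)\to(N,h,\nabla^N)$ between statistical manifolds, $\nabla^u$ and $\overline\nabla^u$ are the connections on $u^{-1}TN$ induced from $\nabla^N$ and $\overline\nabla^N$, and $\langle\cdot,\cdot\rangle$ is the fiber metric induced by $h$. With $\{e_i\}$ a local $g$-orthonormal frame: $\tau(u)=\sum_i(\nabla^u_{e_i}u_*e_i-u_*\nabla^M_{e_i}e_i)$; $\overline\tau(u)=\sum_i(\overline\nabla^u_{e_i}u_*e_i-u_*\overline\nabla^M_{e_i}e_i)$; $\Delta^uV=\sum_i(\nabla^u_{e_i}\nabla^u_{e_i}V-\nabla^u_{\nabla^M_{e_i}e_i}V)$; $\bar\Delta^uV=\sum_i(\overline\nabla^u_{e_i}\overline\nabla^u_{e_i}V-\overline\nabla^u_{\overline\nabla^M_{e_i}e_i}V)$; $\tau_2(u)=\bar\Delta^u\tau(u)+\operatorname{div}^g(T^M)\tau(u)-\sum_iL^N(u_*e_i,\tau(u))u_*e_i-K^N(\tau(u),\tau(u))$. The map $u$ is statistical biharmonic if $\tau_2(u)=0$. Put $$\begin{aligned}\mathcal H_u(V)=&\ \overline R^N(V,\overline\tau(u))\tau(u)+\sum_i(\overline\nabla^N_{u_*e_i}\overline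 R^N)(V,u_*e_i)\tau(u)+2\sum_i\overline R^N(V,u_*e_i)\overline\nabla^u_{e_i}\tau(u)\\&+\sum_i(\overline\nabla^N_V\bar L^N)(\tau(u),u_*e_i)u_*e_i-2\sum_iL^N(u_*e_i,\tau(u))\overline\nabla^u_{e_i}V-(\overline\nabla^N_VK^N)(\tau(u),\tau(u)).\end{aligned}$$ For a relatively compact domain $\Omega\subset M$ (connected, open, compact closure) let $\Gamma_\Omega(u^{-1}TN)$ be the sections with compact support in $\Omega$. A statistical biharmonic map $u$ is stable if for every relatively compact domain $\Omega\subset M$ and every non-zero $V\in\Gamma_\Omega(u^{-1}TN)$, $$\int_\Omega\Big\|\Delta^uV+\sum_iR^N(V,u_*e_i)u_*e_i-2K^N_{\tau(u)}V\Big\|_h^2d\mu_g+\int_\Omega\langle\mathcal H_u(V),V\rangle d\mu_g>0 .$$ *)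

(* Defs.v *)
From HB Require Import structures.
From mathcomp Require Import all_boot all_order all_algebra.
From mathcomp Require Import all_classical all_reals all_analysis.
Set Implicit Arguments.
Unset Strict Implicit.
Unset Printing Implicit Defensive.
Import Order.TTheory GRing.Theory Num.Theory.
Import numFieldNormedType.Exports.
Local Open Scope classical_set_scope.
Local Open Scope ring_scope.

(* Lebesgue measure on R^n, carried by n.-tuple R with its product            *)
(* sigma-algebra: the n-fold product of the Lebesgue measure on R.            *)

Section product_step.
Context (R : realType) (n : nat).
Variable lambda : {sigma_finite_measure set (measurableTypeR R) -> \bar R}.
Variable mu : {sigma_finite_measure set (n.-tuple R) -> \bar R}.

Definition tuple_cons (p : R * n.-tuple R) : n.+1.-tuple R :=
  [the n.+1.-tuple R of p.1 :: p.2].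

Lemma measurable_tuple_cons : measurable_fun setT tuple_cons.
Proof. exact: measurable_cons. Qed.

Definition product_step : set (n.+1.-tuple R) -> \bar R :=
  pushforward (lambda \x mu)%E tuple_cons.

HB.instance Definition _ := Measure.copy product_step
  (measure_function_pushforward__canonical__measure_function_Measure
     (lambda \x mu)%E measurable_tuple_cons).

Lemma product_step_sigma_finite : sigma_finite setT product_step.
Proof.
have /sigma_finiteP[F [FT ndF Foo]] := sigma_finiteT lambda.
have /sigma_finiteP[G [GT ndG Goo]] := sigma_finiteT mu.
pose uncons (t : n.+1.-tuple R) := (tnth t ord0, [tuple of behead t]).
have muncons : measurable_fun [set: n.+1.-tuple R] uncons.
  by apply: measurable_fun_pair; [exact: measurable_tnth | exact: measurable_behead].
have consK : cancel tuple_cons uncons.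
  by move=> [x t]; congr pair; apply: val_inj.
exists (fun k => uncons @^-1` (F k `*` G k)).
  apply/seteqP; split => // t _.
  have : [set: R] (uncons t).1 by [].
  have : [set: n.-tuple R] (uncons t).2 by [].
  rewrite FT GT => -[j _ Gj] [i _ Fi]; exists (maxn i j) => //; split.
    by apply: (subsetPset _ _ (ndF _ _ (leq_maxl i j))).
  by apply: (subsetPset _ _ (ndG _ _ (leq_maxr i j))).
move=> k; have [mF Fk] := Foo k; have [mG Gk] := Goo k.
have mFG : measurable (F k `*` G k) by exact: measurableX.
split; first by rewrite -[X in measurable X]setTI; exact: muncons.
rewrite /product_step /pushforward -comp_preimage.
have -> : uncons \o tuple_cons = id by apply/funext => p; exact: consK.
by rewrite preimage_id product_measure1E// lte_mul_pinfty// ge0_fin_numE.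
Qed.

HB.instance Definition _ := Measure_isSigmaFinite.Build _ _ _ product_step
  product_step_sigma_finite.

End product_step.

Fixpoint lebesgue_tuple (R : realType) (n : nat) :
    {sigma_finite_measure set (n.-tuple R) -> \bar R} :=
  match n with
  | 0 => \d_([tuple] : 0.-tuple R)
  | n'.+1 => product_step (@lebesgue_measure R) (lebesgue_tuple R n')
  end.

Definition rV_of_tuple (R : realType) n (t : n.-tuple R) : 'rV[R]_n :=
  \row_i tnth t i.

Definition integral_rV (R : realType) n (S : set 'rV[R]_n) (F : 'rV[R]_n -> R)
    : \bar R :=
  (\int[lebesgue_tuple R n]_(t in [set t | S (rV_of_tuple t)])
     (F (rV_of_tuple t))%:E)%E.

Section calculus.
Context (R : realType) (n : nat).
Implicit Types U : set 'rV[R]_n.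

Definition basis (i : 'I_n) : 'rV[R]_n := delta_mx 0 i.

Fixpoint iter_partial (W : normedModType R) (s : seq 'I_n) (F : 'rV[R]_n -> W)
    : 'rV[R]_n -> W :=
  if s is i :: s' then 'D_(basis i) (iter_partial s' F) else F.

(* C^oo on the open set U: all iterated partial derivatives exist and are     *)
(* continuous.                                                                *)
Definition smooth_on (W : normedModType R) U (F : 'rV[R]_n -> W) : Prop :=
  forall s x, U x ->
    {for x, continuous (iter_partial s F)} /\
    forall i, derivable (iter_partial s F) x (basis i).

Definition ip (G : 'M[R]_n) (v w : 'rV[R]_n) : R := (v *m G *m w^T) 0 0.

Definition vfield := 'rV[R]_n -> 'rV[R]_n.

Definition metric_field := 'rV[R]_n -> 'M[R]_n.

(* An affine connection in the standard coordinates, given by its Christoffel *)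
(* symbols: C x i j is the coordinate vector of nabla_{d_i} d_j at x.         *)
Definition connection := 'rV[R]_n -> 'I_n -> 'I_n -> 'rV[R]_n.

Implicit Types (G : metric_field) (C : connection) (X Y Z : vfield)
  (x v w z a b c : 'rV[R]_n).

Definition flat : connection := fun _ _ _ => 0.

Definition christoffel C x v w : 'rV[R]_n :=
  \sum_i \sum_j (v 0 i * w 0 j) *: C x i j.

Definition nabla C X Y : vfield :=
  fun x => 'D_(X x) Y x + christoffel C x (X x) (Y x).

Definition bracket X Y : vfield := fun x => 'D_(X x) Y x - 'D_(Y x) X x.

Definition curvature_op C X Y Z : vfield := fun x =>
  nabla C X (nabla C Y Z) x - nabla C Y (nabla C X Z) x
  - nabla C (bracket X Y) Z x.

(* Tensors are evaluated on vectors at a point by extending these to fields   *)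
(* with constant components.                                                  *)
Definition const (v : 'rV[R]_n) : vfield := fun _ => v.

Definition curvature C x v w z : 'rV[R]_n :=
  curvature_op C (const v) (const w) (const z) x.

(* The vector y with ip G y (basis k) = l k for all k. *)
Definition sharp (G : 'M[R]_n) (l : 'I_n -> R) : 'rV[R]_n :=
  (\row_k l k) *m invmx G.

Definition dmetric G x v w z : R :=
  'D_v (fun y => ip (G y) w z : R^o) x.

Definition levi_civita G : connection := fun x i j =>
  sharp (G x) (fun k => 2%:R^-1 *
    (dmetric G x (basis i) (basis j) (basis k)
     + dmetric G x (basis j) (basis i) (basis k)
     - dmetric G x (basis k) (basis i) (basis j))).

(* X g(Y,Z) = g(nabla_X Y, Z) + g(Y, nabla-bar_X Z), solved for nabla-bar:    *)
(* see conjugateE.                                                            *)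
Definition conjugate G C : connection := fun x i j =>
  sharp (G x) (fun k =>
    dmetric G x (basis i) (basis k) (basis j) - ip (G x) (C x i k) (basis j)).

Definition difference G C x v w : 'rV[R]_n :=
  christoffel C x v w - christoffel (levi_civita G) x v w.

(* L(z,w)v, determined by g(L(z,w)v, y) = g(R(v,y)z, w): see LtensorE. *)
Definition Ltensor G C x z w v : 'rV[R]_n :=
  sharp (G x) (fun k => ip (G x) (curvature C x v (basis k) z) w).

(* (nabla_v g)(w, z) *)
Definition nabla_metric G C x v w z : R :=
  dmetric G x v w z - ip (G x) (christoffel C x v w) z
  - ip (G x) w (christoffel C x v z).

(* (nabla_v A)(a, b) for a tensor field A of type (1,2) *)
Definition nabla_tensor2 C (A : 'rV[R]_n -> 'rV[R]_n -> 'rV[R]_n -> 'rV[R]_n)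
    x v a b : 'rV[R]_n :=
  nabla C (const v) (fun y => A y a b) x
  - A x (christoffel C x v a) b - A x a (christoffel C x v b).

(* (nabla_v A)(a, b, c) for a tensor field A of type (1,3) *)
Definition nabla_tensor3 C
    (A : 'rV[R]_n -> 'rV[R]_n -> 'rV[R]_n -> 'rV[R]_n -> 'rV[R]_n)
    x v a b c : 'rV[R]_n :=
  nabla C (const v) (fun y => A y a b c) x
  - A x (christoffel C x v a) b c - A x a (christoffel C x v b) c
  - A x a b (christoffel C x v c).

Definition riemannian_on U G : Prop :=
  smooth_on U G /\
  forall x, U x ->
    (forall v w, ip (G x) v w = ip (G x) w v) /\
    (forall v, v != 0 -> 0 < ip (G x) v v).

Definition statistical_on U G C : Prop :=
  [/\ riemannian_on U G,
      forall i j, smooth_on U (fun x => C x i j),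
      forall x, U x -> forall v w, christoffel C x v w = christoffel C x w v &
      forall x, U x -> forall v w z,
        nabla_metric G C x v w z = nabla_metric G C x w v z].

Definition orthonormal_frame_on U G (e : 'I_n -> vfield) : Prop :=
  (forall i, smooth_on U (e i)) /\
  forall x, U x -> forall i j, ip (G x) (e i x) (e j x) = (i == j)%:R.

Definition tchebychev G C (e : 'I_n -> vfield) : vfield :=
  fun x => \sum_i difference G C x (e i x) (e i x).

Definition divergence G X x : R :=
  \sum_i nabla (levi_civita G) (const (basis i)) X x 0 i.

End calculus.

Arguments flat {R n}.

Section identities.
Context (R : realType) (n : nat).
Implicit Types (G : metric_field R n) (C : connection R n).

Lemma sharpE (G : 'M[R]_n) (l : 'I_n -> R) k :
  G \in unitmx -> ip G (sharp G l) (basis R k) = l k.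
Proof.
move=> Gu; rewrite /ip /sharp mulmxKV// mxE (bigD1 k)//= big1 ?addr0.
  by rewrite !mxE !eqxx mulr1.
by move=> j jk; rewrite !mxE eqxx (negbTE jk) mulr0.
Qed.

Lemma conjugateE G C x i j k : G x \in unitmx -> (G x)^T = G x ->
  dmetric G x (basis R i) (basis R k) (basis R j) =
  ip (G x) (C x i k) (basis R j) + ip (G x) (basis R k) (conjugate G C x i j).
Proof.
move=> Gu Gs.
have ipC v w : ip (G x) v w = ip (G x) w v.
  rewrite /ip; transitivity ((v *m G x *m w^T)^T 0 0); first by rewrite [RHS]mxE.
  by rewrite !trmx_mul trmxK Gs mulmxA.
by rewrite [X in _ + X]ipC sharpE// addrC subrK.
Qed.

Lemma LtensorE G C x z w v k : G x \in unitmx ->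
  ip (G x) (Ltensor G C x z w v) (basis R k) =
  ip (G x) (curvature C x v (basis R k) z) w.
Proof. exact: sharpE. Qed.

End identities.

(* Maps u from an open subset of (R^m, G, C), thought of as a chart of M, to  *)
(* (R^n, h, D); sections of u^{-1}TR^n are functions V : R^m -> R^n.          *)

Section maps.
Context (R : realType) (m n : nat).
Variables (u : 'rV[R]_m -> 'rV[R]_n).
Implicit Types (V : 'rV[R]_m -> 'rV[R]_n) (X : vfield R m)
  (e : 'I_m -> vfield R m) (x : 'rV[R]_m).

Definition push X : 'rV[R]_m -> 'rV[R]_n := fun x => 'D_(X x) u x.

Definition nabla_along (D : connection R n) X V : 'rV[R]_m -> 'rV[R]_n :=
  fun x => 'D_(X x) V x + christoffel D (u x) (push X x) (V x).

Definition tension (C : connection R m) (D : connection R n) e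
    : 'rV[R]_m -> 'rV[R]_n := fun x =>
  \sum_i (nabla_along D (e i) (push (e i)) x - push (nabla C (e i) (e i)) x).

Definition laplacian (C : connection R m) (D : connection R n) e V
    : 'rV[R]_m -> 'rV[R]_n := fun x =>
  \sum_i (nabla_along D (e i) (nabla_along D (e i) V) x
          - nabla_along D (nabla C (e i) (e i)) V x).

Variables (G : metric_field R m) (C : connection R m).
Variables (h : metric_field R n) (D : connection R n).

Let Cbar := conjugate G C.
Let Dbar := conjugate h D.

Definition bitension e : 'rV[R]_m -> 'rV[R]_n := fun x =>
  let tau := tension C D e in
  laplacian Cbar Dbar e tau x
  + divergence G (tchebychev G C e) x *: tau x
  - \sum_i Ltensor h D (u x) (push (e i) x) (tau x) (push (e i) x)
  - difference h D (u x) (tau x) (tau x).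

(* H_u(V) *)
Definition curlyH e V : 'rV[R]_m -> 'rV[R]_n := fun x =>
  let tau := tension C D e in
  let y := u x in
  let du i := push (e i) x in
  curvature Dbar y (V x) (tension Cbar Dbar e x) (tau x)
  + \sum_i nabla_tensor3 Dbar (curvature Dbar) y (du i) (V x) (du i) (tau x)
  + 2%:R *: \sum_i curvature Dbar y (V x) (du i) (nabla_along Dbar (e i) tau x)
  + \sum_i nabla_tensor3 Dbar (Ltensor h Dbar) y (V x) (tau x) (du i) (du i)
  - 2%:R *: \sum_i Ltensor h D y (du i) (tau x) (nabla_along Dbar (e i) V x)
  - nabla_tensor2 Dbar (difference h D) y (V x) (tau x) (tau x).

(* Delta^u V + sum_i R^N(V, u_* e_i) u_* e_i - 2 K^N_{tau(u)} V *)
Definition jacobi_part e V : 'rV[R]_m -> 'rV[R]_n := fun x =>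
  laplacian C D e V x
  + \sum_i curvature D (u x) (V x) (push (e i) x) (push (e i) x)
  - 2%:R *: difference h D (u x) (tension C D e x) (V x).

End maps.

(* Manifolds: Hausdorff spaces with a countable smooth atlas.  The charts     *)
(* are indexed by nat; some of them may be empty.                             *)

Record smooth_atlas (R : realType) (m : nat) (M : topologicalType) := SmoothAtlas {
  dom : nat -> set M ;
  chart : nat -> M -> 'rV[R]_m ;
  param : nat -> 'rV[R]_m -> M ;
  atlas_hausdorff : hausdorff_space M ;
  dom_open : forall k, open (dom k) ;
  img_open : forall k, open (chart k @` dom k) ;
  chartK : forall k p, dom k p -> param k (chart k p) = p ;
  chart_continuous : forall k p, dom k p -> {for p, continuous (chart k)} ;
  param_continuous : forall k x,
    (chart k @` dom k) x -> {for x, continuous (param k)} ;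
  dom_cover : \bigcup_k dom k = setT ;
  transition_smooth : forall k l,
    smooth_on (chart k @` (dom k `&` dom l)) (chart l \o param k)
}.

Section manifold.
Context (R : realType) (m : nat) (M : topologicalType).
Variable A : smooth_atlas R m M.

Definition img k : set 'rV[R]_m := chart A k @` dom A k.

Definition transition k l : 'rV[R]_m -> 'rV[R]_m := chart A l \o param A k.

(* o k p tells whether the chart k reverses the orientation at p. *)
Definition orientable : Prop :=
  exists o : nat -> M -> bool,
    (forall k p, dom A k p -> \forall q \near p, o k q = o k p) /\
    forall k l p, dom A k p -> dom A l p ->
      0 < (-1) ^+ (o k p) * (-1) ^+ (o l p) *
          \det (\matrix_(i, j)
                 ('D_(basis R i) (transition k l) (chart A k p)) 0 j).

Definition smooth_map (W : normedModType R) (f : M -> W) : Prop :=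
  forall k, smooth_on (img k) (f \o param A k).

(* Tensor fields and connections on M are given by their expressions g k, C k *)
(* in the charts, related by the usual transformation rules.                  *)
Definition statistical (g : nat -> metric_field R m) (C : nat -> connection R m)
    : Prop :=
  (forall k, statistical_on (img k) (g k) (C k)) /\
  forall k l p, dom A k p -> dom A l p ->
    let x := chart A k p in let phi := transition k l in
    forall v w : 'rV[R]_m,
      ip (g k x) v w = ip (g l (phi x)) ('D_v phi x) ('D_w phi x) /\
      push phi (nabla (C k) (const v) (const w)) x =
        nabla_along phi (C l) (const v) (push phi (const w)) x.

(* The integral over Omega of a function with expression F k in the chart k,  *)
(* for the Riemannian measure of g: Omega is cut into the Borel pieces        *)
(* Omega `&` (dom k minus the dom j, j < k).  When F has compact support only *)
(* finitely many pieces contribute.                                           *)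
Definition integral_mfd (g : nat -> metric_field R m) (Omega : set M)
    (F : nat -> 'rV[R]_m -> R) : \bar R :=
  (\sum_(k <oo) integral_rV (chart A k @` (Omega `&` seqDU (dom A) k))
     (fun x => F k x * Num.sqrt (\det (g k x)))%R)%E.

Definition relatively_compact_domain (Omega : set M) : Prop :=
  [/\ connected Omega, open Omega & compact (closure Omega)].

Definition compact_support_in (V0 : zmodType) (Omega : set M) (V : M -> V0)
    : Prop :=
  let supp := closure [set p | V p != 0] in compact supp /\ supp `<=` Omega.

(* Sums over a local orthonormal frame do not depend on it; the frames on the *)
(* charts are universally quantified, and exist by Gram-Schmidt.              *)
Section biharmonic.
Variables (n : nat) (g : nat -> metric_field R m) (C : nat -> connection R m).
Variables (h : metric_field R n) (D : connection R n) (u : M -> 'rV[R]_n).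

Definition statistical_biharmonic : Prop :=
  smooth_map u /\
  forall k e, orthonormal_frame_on (img k) (g k) e ->
    forall x, img k x -> bitension (u \o param A k) (g k) (C k) h D e x = 0.

Definition stable_statistical_biharmonic : Prop :=
  statistical_biharmonic /\
  forall e : nat -> 'I_m -> vfield R m,
    (forall k, orthonormal_frame_on (img k) (g k) (e k)) ->
  forall (Omega : set M) (V : M -> 'rV[R]_n),
    relatively_compact_domain Omega ->
    smooth_map V -> compact_support_in Omega V -> (exists p, V p != 0) ->
  let u_ k := u \o param A k in
  let V_ k := V \o param A k in
  (0 < integral_mfd g Omega (fun k x =>
         let W := jacobi_part (u_ k) (C k) h D (e k) (V_ k) x in
         ip (h (u_ k x)) W W)
       + integral_mfd g Omega (fun k x =>
         ip (h (u_ k x))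
            (curlyH (u_ k) (g k) (C k) h D (e k) (V_ k) x)
            (V_ k x)))%E.

End biharmonic.

Section immersion.
Variables (f xi : M -> 'rV[R]_m.+1).
Variables (g : nat -> metric_field R m) (C : nat -> connection R m).
Variable S : nat -> 'rV[R]_m -> 'M[R]_m.

Let f_ k := f \o param A k.
Let xi_ k := xi \o param A k.

Definition immersion : Prop :=
  smooth_map f /\
  forall k x, img k x -> forall v : 'rV[R]_m, 'D_v (f_ k) x = 0 -> v = 0.

Definition transversal : Prop :=
  smooth_map xi /\
  forall k x, img k x -> forall v : 'rV[R]_m, 'D_v (f_ k) x <> xi_ k x.

(* The formulas of Gauss and Weingarten; the latter contains the condition    *)
(* that xi is equiaffine.  The shape operator maps a row vector v to v *m S.  *)
Definition gauss_weingarten : Prop :=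
  forall k (X Y : vfield R m), smooth_on (img k) X -> smooth_on (img k) Y ->
  forall x, img k x ->
    nabla_along (f_ k) flat X (push (f_ k) Y) x =
      push (f_ k) (nabla (C k) X Y) x + ip (g k x) (X x) (Y x) *: xi_ k x /\
    nabla_along (f_ k) flat X (xi_ k) x =
      - push (f_ k) (fun y => X y *m S k y) x.

Definition locally_convex : Prop :=
  forall k x, img k x -> forall v : 'rV[R]_m, v != 0 -> 0 < ip (g k x) v v.

(* |det(f_* X_1, ..., f_* X_m, xi)| = sqrt (det (g(X_i, X_j))) *)
Definition affine_normal : Prop :=
  forall k x, img k x -> forall X : 'I_m -> 'rV[R]_m,
    `| \det (\matrix_(i < m.+1)
              if unlift ord_max i is Some j then 'D_(X j) (f_ k) x
              else xi_ k x) |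
    = Num.sqrt (\det (\matrix_(i, j) ip (g k x) (X i) (X j))).

Definition blaschke_immersion : Prop :=
  [/\ immersion, transversal, gauss_weingarten & affine_normal].

Definition locally_convex_improper_affine_sphere : Prop :=
  [/\ blaschke_immersion, locally_convex &
      forall k x, img k x -> S k x = 0].

End immersion.

End manifold.

(* A Riemannian metric on R^n that is parallel for the standard connection.   *)
Definition euclidean_metric (R : realType) n (h : metric_field R n) : Prop :=
  riemannian_on setT h /\
  forall x v w z : 'rV[R]_n, nabla_metric h flat x v w z = 0.

(* Main.v *)
From mathcomp Require Import all_boot all_order all_algebra.
From mathcomp Require Import all_classical all_reals all_analysis.
From mathcomp Require Import perm lra.
Require Import Defs.
Set Implicit Arguments.
Unset Strict Implicit.
Unset Printing Implicit Defensive.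
Import Order.TTheory GRing.Theory Num.Theory.
Import numFieldNormedType.Exports.
Local Open Scope classical_set_scope.
Local Open Scope ring_scope.

(** An improper affine sphere has S = 0, so its affine normal xi is locally
    constant, and the Gauss formula reads Hess f (v, w) = g(v, w) xi, where
    Hess is taken with respect to the induced connection.  Tracing it over an
    orthonormal frame gives tau(f) = Delta f = m xi.

    Biharmonicity.  The target is flat and its metric is parallel, so the
    curvature, L and K of the target vanish and the bitension field is
    Delta-bar tau + div(T) tau.  The first term is zero because xi has zero
    derivative.  The second is zero because T = 0 for a Blaschke immersion: the
    frame (d_1 f, ..., d_m f, xi) has a determinant whose square is det g;
    the logarithmic derivatives along d_c give 2 Gamma_ca^a = tr (g^-1 d_c g),
    and by the Codazzi equation the difference of the two sides is the c-th
    component of T, up to a factor ([is_derive_det], [tchebychev_trace], [tchebychev_immersion]).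

    Stability.  For the same reasons the second integrand vanishes and the first
    one is |Delta V|^2.  It remains to see that a non-zero V with compact support
    cannot satisfy Delta V = 0.  This is the maximum principle, with f itself
    providing a strictly subharmonic function: Delta <f, xi> = m |xi|^2 > 0.
    With c = V(p0) <> 0 and a small eps > 0, the function
    <V, c> + eps <f, xi> takes its maximum over the support of V at a point
    where V <> 0, hence at a local maximum; there its Laplacian is at most 0,
    although Delta V = 0 would make it positive ([lap_neq0_at_max],
    [exists_nonharmonic]).  The argument also covers a compact M, and thereby
    shows that there is no compact improper affine sphere.

    Delta V is thus non-zero at some point of the domain.  To conclude that the
    integral, which is computed piece by piece over a disjointed atlas, is
    positive, take the least k such that Delta V is non-zero at a point of the
    k-th chart.  As Delta V does not depend on the chart ([lap_chart]), a
    neighbourhood of this point avoids the earlier charts, so that it lies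
    entirely in the k-th piece ([integral_mfd_energy_gt0]).

    Smoothness is given by the existence and continuity of iterated partial
    derivatives, so the linearity of directional derivatives and the chain
    rule for continuously differentiable maps are established first
    ([is_derive_comp_C1]). *)

(** * Directional derivatives and the chain rule *)

Section directional.
Context (R : realType) (V W : normedModType R).
Implicit Types (F : V -> W) (x v : V) (d : W) (t : R).

(** Reduces derivatives along v to derivatives of functions of one variable, to
    which the mean value theorem and the calculus of extrema apply. *)
Lemma is_derive_line F x v d t :
  is_derive t (1 : R) (fun s => F (s *: v + x)) d <->
  is_derive (t *: v + x) v F d.
Proof.
have E : (fun h : R => h^-1 *: (((fun s => F (s *: v + x)) \o shift t) (h *: 1)
             - F (t *: v + x)))
       = (fun h : R => h^-1 *: ((F \o shift (t *: v + x)) (h *: v)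
             - F (t *: v + x))).
  by apply/funext => h /=; rewrite [_%:A]mulr1 scalerDl addrA.
by split=> -[]; rewrite /derivable /derive ?E -?E => a b; split;
   rewrite /derivable /derive ?E -?E.
Qed.

Lemma is_derive_line0 F x v d :
  is_derive (0 : R) (1 : R) (fun s => F (s *: v + x)) d <-> is_derive x v F d.
Proof. by have := is_derive_line F x v d 0; rewrite scale0r add0r. Qed.

Lemma derive_locally0 F (U : set V) x v :
  open U -> U x -> (forall y, U y -> F y = 0) -> 'D_v F x = 0.
Proof.
move=> oU Ux F0; rewrite -(derive_cst (0 : W) x v).
by apply: near_eq_derive; near do apply: F0; exact: open_nbhs_nbhs.
Unshelve. all: by end_near. Qed.

End directional.

Section mean_value.
Context (R : realType) (V : normedModType R).
Implicit Types (F : V -> R) (x v : V).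

(** The increment h may have any sign, or be zero: the mean value theorem is
    applied on [0, 1], to the parametrization by s * h. *)
Lemma MVT_line F x v (h : R) :
  (forall t : R, 0 <= t <= 1 -> derivable F ((t * h) *: v + x) v) ->
  exists2 t : R, 0 < t < 1 &
    F (h *: v + x) - F x = h * 'D_v F ((t * h) *: v + x).
Proof.
move=> dF; pose g (s : R) : R := F ((s * h) *: v + x).
have dg (t : R) : 0 <= t <= 1 ->
    is_derive t (1 : R) g (h * 'D_v F ((t * h) *: v + x)).
  move=> t01.
  have /is_derive_line [d1 d2] := derivableP (dF t t01).
  pose k (s : R) : R := s * h.
  have [k1 k2] : is_derive t (1 : R) k h.
    apply: is_derive_eq (is_deriveM (is_derive_id t 1) (is_derive_cst h t 1)) _.
    by rewrite scaler0 add0r [_%:A]mulr1.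
  have gE : g = (fun s => F (s *: v + x)) \o k by [].
  split.
    apply/derivable1_diffP; rewrite gE; apply: differentiable_comp.
      exact/derivable1_diffP.
    exact/derivable1_diffP.
  by rewrite -derive1E gE derive1_comp// !derive1E d2 k2 mulrC.
have [||t t01] := @MVT R g (fun t : R => h * 'D_v F ((t * h) *: v + x)) 0 1 ltr01.
- by move=> t; rewrite in_itv /= => /andP[a b]; apply: dg; rewrite !ltW.
- apply: derivable_within_continuous => t; rewrite in_itv /= => t01.
  by have [] := dg t t01.
by rewrite /g mul1r mul0r scale0r add0r subr0 mulr1 => ->; exists t.
Qed.

End mean_value.

Section chain_rule.
Context (R : realType) (m : nat).
Implicit Types (F : 'rV[R]_m -> R) (g : R -> 'rV[R]_m).

(** The inductive step of the chain rule: the curve g is moved by c along a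
    single direction b.  The mean value theorem writes the increment of F as
    c h times the derivative of F along b at an intermediate point, and this
    derivative is continuous; the remaining directions enter through F \o g. *)
Lemma is_derive_add_coord F (U : set 'rV[R]_m) (b : 'rV[R]_m) g (c : R -> R)
    (d c' : R) :
  open U -> U (g 0) -> (forall y, U y -> derivable F y b) ->
  {for g 0, continuous ('D_b F)} -> {for 0, continuous g} ->
  is_derive (0 : R) (1 : R) (F \o g) d -> is_derive (0 : R) (1 : R) c c' ->
  c 0 = 0 ->
  is_derive (0 : R) (1 : R) (fun t => F (c t *: b + g t))
    (d + c' * 'D_b F (g 0)).
Proof.
move=> oU Ug dF cF cg [dg1 dg2] [dc1 dc2] c0.
have cc : {for (0 : R), continuous c}.
  by apply: differentiable_continuous; exact/derivable1_diffP.
pose e := 'D_b F (g 0).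
have key : h^-1 *: (F (c h *: b + g h) - F (g h)) @[h --> 0^'] --> c' * e.
  have cvc : h^-1 * c h @[h --> (0 : R)^'] --> c'.
    rewrite -dc2; apply: cvg_trans dc1; apply: near_eq_cvg; near=> h.
    by rewrite /= c0 subr0 addr0 [_%:A]mulr1.
  pose rad h := `|c h| * `|b| + `|g h - g 0|.
  have rad0 : rad h @[h --> (0 : R)] --> 0.
    have cvc0 : `|c h| @[h --> (0 : R)] --> (0 : R).
      by have /cvg_norm := cc; rewrite c0 normr0.
    have cvg0 : `|g h - g 0| @[h --> (0 : R)] --> (0 : R).
      by apply/norm_cvg0P/subr_cvg0.
    have /(cvgD (cvgMr_tmp (b := `|b|) cvc0)) := cvg0.
    by rewrite mul0r addr0.
  (* y is an intermediate point; a choice of such a y for every h near 0 turns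
     the continuity of 'D_b F into a limit in h. *)
  pose P h y := F (c h *: b + g h) - F (g h) = c h * 'D_b F y /\
                `|y - g 0| <= rad h.
  have Pex : \forall h \near (0 : R), exists y, P h y.
    have /nbhs_ballP[r /= r0 rU] : nbhs (g 0) U by exact: open_nbhs_nbhs.
    near=> h.
    have lt_r : rad h < r.
      by near: h; apply: (cvgr_lt 0).
    have dist (t : R) : 0 <= t <= 1 -> `|((t * c h) *: b + g h) - g 0| <= rad h.
      move=> /andP[t0 t1]; rewrite -addrA (le_trans (ler_normD _ _))// lerD2r.
      rewrite normrZ normrM ler_wpM2r// ler_piMl// ger0_norm//.
    have [|t /andP[t0 t1] E] := @MVT_line _ _ F (g h) b (c h).
      move=> t t01; apply/dF/rU; rewrite -ball_normE /ball_ /= distrC.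
      exact: le_lt_trans (dist _ t01) lt_r.
    by exists ((t * c h) *: b + g h); split=> //; apply: dist; rewrite !ltW.
  pose y h := xget (g 0) [set y | P h y].
  have yP : \forall h \near (0 : R), P h (y h).
    by near do apply: xgetPex.
  have cvy : y h @[h --> (0 : R)] --> g 0.
    apply/subr_cvg0; apply/norm_cvg0P.
    apply: (squeeze_cvgr _ (cvg_cst 0) rad0).
    by near=> h; rewrite normr_ge0 /=; have [] : P h (y h) by near: h.
  have cvD : 'D_b F (y h) @[h --> (0 : R)^'] --> e.
    by apply: (cvg_comp y ('D_b F)) cF; apply: cvg_within_filter.
  apply: cvg_trans (cvgM cvc cvD); apply: near_eq_cvg.
  have yP' : \forall h \near (0 : R)^', P h (y h) by exact: nbhs_dnbhs.
  near=> h.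
  have [E _] : P h (y h) by near: h.
  by rewrite E /= /GRing.scale /= mulrA.
have cvg1 : h^-1 *: (F (c h *: b + g h) - F (c 0 *: b + g 0)) @[h --> 0^'] -->
    d + c' * e.
  rewrite -dg2; apply: cvg_trans (cvgD dg1 key); apply: near_eq_cvg; near=> h.
  rewrite [LHS]/GRing.add /= c0 scale0r add0r addr0 [_%:A]mulr1 -scalerDr.
  by congr (_ *: _); rewrite addrC subrKA.
have E : (fun h : R => h^-1 *: (((fun t => F (c t *: b + g t)) \o shift 0) (h *: 1)
     - F (c 0 *: b + g 0))) =
   (fun h => h^-1 *: (F (c h *: b + g h) - F (c 0 *: b + g 0))).
  by apply/funext => h /=; rewrite addr0 [_%:A]mulr1.
split; first by apply/cvg_ex; exists (d + c' * e); rewrite E.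
by rewrite /derive E; apply/cvg_lim.
Unshelve. all: by end_near. Qed.

End chain_rule.

Section continuously_differentiable.
Context (R : realType) (m : nat).
Implicit Types (U : set 'rV[R]_m) (x v : 'rV[R]_m).

Definition C1_on (W : normedModType R) U (F : 'rV[R]_m -> W) :=
  forall x, U x -> forall i,
    derivable F x (basis R i) /\ {for x, continuous ('D_(basis R i) F)}.

Lemma smooth_on_C1 (W : normedModType R) U (F : 'rV[R]_m -> W) s :
  smooth_on U F -> C1_on U (iter_partial s F).
Proof.
move=> sF x Ux i; split; first exact: (sF s x Ux).2.
exact: (sF (i :: s) x Ux).1.
Qed.

(** Vectors are rows, so this is the transpose of the usual Jacobian matrix: row
    i is the i-th partial derivative, and the derivative along v is
    v *m jacobi F x. *)
Definition jacobi n (F : 'rV[R]_m -> 'rV[R]_n) x : 'M[R]_(m, n) :=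
  \matrix_(i, a) ('D_(basis R i) F x) 0 a.

Lemma rV_basis x : x = \sum_i x 0 i *: basis R i.
Proof. exact: row_sum_delta. Qed.

(** The coordinates of the curve are switched on one after the other, each at the
    price of one application of [is_derive_add_coord]. *)
Lemma is_derive_comp_C1 U (F : 'rV[R]_m -> R) (g : R -> 'rV[R]_m) dg :
  open U -> U (g 0) -> C1_on U (F : _ -> R^o) -> is_derive (0 : R) (1 : R) g dg ->
  is_derive (0 : R) (1 : R) (F \o g)
    (\sum_i dg 0 i * 'D_(basis R i) (F : _ -> R^o) (g 0)).
Proof.
move=> oU Ug CF [dg1 dg2].
have dgi i : is_derive (0 : R) (1 : R) (fun t => g t 0 i - g 0 0 i) (dg 0 i).
  have di : derivable (fun t => g t 0 i) 0 1 by exact: (derivable_mxP _ _ _).1.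
  have -> : (fun t => g t 0 i - g 0 0 i) = (fun t => g t 0 i) - cst (g 0 0 i) by [].
  have := is_deriveB (derivableP di) (is_derive_cst (g 0 0 i) _ _).
  by rewrite -dg2 derive_mx// mxE subr0.
(* The curve in which only the coordinates in s move. *)
pose gs s t := \sum_(i <- s) (g t 0 i - g 0 0 i) *: basis R i + g 0.
have gs0 s : gs s 0 = g 0.
  by rewrite /gs big1 ?add0r// => i _; rewrite subrr scale0r.
have gsT : gs (index_enum 'I_m) = g.
  apply/funext => t; rewrite /gs; under eq_bigr do rewrite scalerBl.
  by rewrite sumrB -!rV_basis subrK.
have cgs s : {for 0, continuous (gs s)}.
  have -> : gs s = \sum_(i <- s) (fun t => (g t 0 i - g 0 0 i) *: basis R i) + cst (g 0).
    by apply/funext => t; rewrite /gs -[RHS]/(_ t + g 0) fct_sumE.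
  apply: (@continuousD _ _ _ _ _ 0); last exact: cst_continuous.
  elim/big_ind: _ => [|a b ca cb|i _].
  - exact: cst_continuous.
  - exact: (@continuousD _ _ _ a b 0).
  have ci : {for (0 : R), continuous (fun t => g t 0 i - g 0 0 i)}.
    apply: differentiable_continuous.
    by apply/derivable1_diffP; have [] := dgi i.
  exact: (cvgZr_tmp ci).
rewrite -[in F \o g]gsT.
elim: (index_enum 'I_m) => [|i s IHs].
  rewrite big_nil; have -> : F \o gs [::] = cst (F (g 0)).
    by apply/funext => t; rewrite /gs /= big_nil add0r.
  exact: is_derive_cst.
rewrite big_cons addrC -(gs0 s).
have -> : F \o gs (i :: s) =
    (fun t => F ((g t 0 i - g 0 0 i) *: basis R i + gs s t)).
  by apply/funext => t; rewrite /gs /= big_cons addrA.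
apply: (is_derive_add_coord oU); rewrite ?gs0//.
- by move=> y Uy; exact: (CF y Uy i).1.
- exact: (CF _ Ug i).2.
- by rewrite subrr.
Qed.

End continuously_differentiable.

(** * Derivatives of matrix-valued functions *)
Section matrix_derivatives.
Context (R : realType) (V : normedModType R).
Implicit Types (x v : V).

Lemma derive_coord p q (F : V -> 'M[R]_(p, q)) x v i j :
  derivable F x v -> 'D_v (fun y => F y i j) x = ('D_v F x) i j.
Proof. by move=> dF; rewrite derive_mx// mxE. Qed.

Lemma is_derive_mxP p q (F : V -> 'M[R]_(p, q)) x v d :
  is_derive x v F d <-> forall i j, is_derive x v (fun y => F y i j) (d i j).
Proof.
split=> [[dF <-] i j|dF].
  by split; [exact: (derivable_mxP _ _ _).1|exact: derive_coord].
have dF' : derivable F x v by apply/derivable_mxP => i j; have [] := dF i j.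
split=> //; apply/matrixP => i j; rewrite -derive_coord//.
by have [] := dF i j.
Qed.

Lemma is_derive_bigsum (I : Type) (s : seq I) (W : normedModType R)
    (F : I -> V -> W) x v d :
  (forall i, is_derive x v (F i) (d i)) ->
  is_derive x v (fun y => \sum_(i <- s) F i y) (\sum_(i <- s) d i).
Proof.
move=> dF; elim: s => [|i s IHs].
  under eq_fun do rewrite big_nil.
  by rewrite big_nil; exact: is_derive_cst.
under eq_fun do rewrite big_cons.
by rewrite big_cons; exact: is_deriveD.
Qed.

Lemma is_derive_mulmx p q r (A : V -> 'M[R]_(p, q)) (B : V -> 'M[R]_(q, r))
    x v dA dB :
  is_derive x v A dA -> is_derive x v B dB ->
  is_derive x v (fun y => A y *m B y) (dA *m B x + A x *m dB).
Proof.
move=> /is_derive_mxP hA /is_derive_mxP hB; apply/is_derive_mxP => i j.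
rewrite !mxE -big_split /=.
under eq_fun do rewrite mxE.
apply: is_derive_bigsum => k.
apply: is_derive_eq (is_deriveM (hA i k) (hB k j)) _.
by rewrite /GRing.scale /= addrC mulrC [X in _ + X]mulrC [X in X + _]mulrC.
Qed.

Lemma is_derive_mulmxl p q r (A : 'M[R]_(p, q)) (B : V -> 'M[R]_(q, r)) x v dB :
  is_derive x v B dB -> is_derive x v (fun y => A *m B y) (A *m dB).
Proof.
move=> hB; apply: is_derive_eq (is_derive_mulmx (is_derive_cst A x v) hB) _.
by rewrite mul0mx add0r.
Qed.

Lemma is_derive_mulmxr p q r (A : V -> 'M[R]_(p, q)) (B : 'M[R]_(q, r)) x v dA :
  is_derive x v A dA -> is_derive x v (fun y => A y *m B) (dA *m B).
Proof.
move=> hA; apply: is_derive_eq (is_derive_mulmx hA (is_derive_cst B x v)) _.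
by rewrite mulmx0 addr0.
Qed.

Lemma is_derive_trmx p q (A : V -> 'M[R]_(p, q)) x v dA :
  is_derive x v A dA -> is_derive x v (fun y => (A y)^T) dA^T.
Proof.
move=> /is_derive_mxP hA; apply/is_derive_mxP => i j.
by rewrite mxE; under eq_fun do rewrite mxE; exact: hA.
Qed.

End matrix_derivatives.

Section jacobian.
Context (R : realType) (m : nat).
Implicit Types (U : set 'rV[R]_m).

Lemma C1_on_coord p q U (F : 'rV[R]_m -> 'M[R]_(p, q)) i j :
  open U -> C1_on U F -> C1_on U (fun y => F y i j : R^o).
Proof.
move=> oU CF x Ux k; have [dF cF] := CF x Ux k; split.
  exact: (derivable_mxP _ _ _).1.
have cF' : ('D_(basis R k) F y) i j @[y --> x] --> ('D_(basis R k) F x) i j.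
  exact: (cvg_comp _ _ cF (@coord_continuous _ _ _ i j _)).
have E y : U y ->
    ('D_(basis R k) F y) i j = 'D_(basis R k) (fun y => F y i j : R^o) y.
  by move=> Uy; apply/esym/derive_coord; exact: (CF y Uy k).1.
have nE : \forall y \near x,
    ('D_(basis R k) F y) i j = 'D_(basis R k) (fun y => F y i j : R^o) y.
  by near=> y; apply: E; near: y; exact: open_nbhs_nbhs.
rewrite /prop_for /continuous_at -(E x Ux).
exact: cvg_trans (near_eq_cvg nE) cF'.
Unshelve. all: by end_near. Qed.

(** Serves for changes of charts and, with the identity for phi, for the linearity
    of the derivative in the direction v. *)
Lemma is_derive_comp (V : normedModType R) n U (F : 'rV[R]_m -> 'rV[R]_n)
    (phi : V -> 'rV[R]_m) x v d :
  open U -> U (phi x) -> C1_on U F -> is_derive x v phi d ->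
  is_derive x v (F \o phi) (d *m jacobi F (phi x)).
Proof.
move=> oU Ux CF /is_derive_line0 dphi; apply/is_derive_mxP => i j.
rewrite ord1; apply/is_derive_line0.
have Ux0 : U (phi (0 *: v + x)) by rewrite scale0r add0r.
have := is_derive_comp_C1 oU Ux0 (C1_on_coord 0 j oU CF) dphi.
rewrite scale0r add0r => /is_derive_eq; apply.
rewrite mxE; apply: eq_bigr => k _; rewrite mxE derive_coord//.
by have [] := CF _ Ux k.
Qed.

Lemma is_derive_C1 n U (F : 'rV[R]_m -> 'rV[R]_n) x v :
  open U -> U x -> C1_on U F -> is_derive x v F (v *m jacobi F x).
Proof. by move=> oU Ux CF; exact: (is_derive_comp oU Ux CF (is_derive_id x v)). Qed.

End jacobian.

(** * The derivative of the determinant *)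
Section determinant.
Context (R : realType) (V : normedModType R).
Implicit Types (x v : V).

(** The i-th summand has its i-th factor differentiated in place, so that the
    Leibniz formula turns the derivative of a determinant into a sum of
    determinants. *)
Lemma is_derive_bigprod (I : eqType) (s : seq I) (F : I -> V -> R) x v
    (d : I -> R) :
  uniq s -> (forall i, is_derive x v (F i : V -> R^o) (d i)) ->
  is_derive x v (fun y => \prod_(i <- s) F i y : R^o)
    (\sum_(i <- s) \prod_(j <- s) (if j == i then d j else F j x)).
Proof.
move=> + dF; elim: s => [_|i s IHs /=/andP[nis us]].
  under eq_fun do rewrite big_nil.
  by rewrite big_nil; exact: is_derive_cst.
under eq_fun do rewrite big_cons.
apply: is_derive_eq (is_deriveM (dF i) (IHs us)) _.
rewrite big_cons addrC /GRing.scale /=; congr (_ + _).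
  rewrite big_cons eqxx mulrC; congr (_ * _); apply: eq_big_seq => j js.
  by case: eqP => // ji; rewrite ji (negPf nis) in js.
rewrite mulr_sumr; apply: eq_big_seq => j js; rewrite big_cons.
by case: eqP => // ij; rewrite -ij (negPf nis) in js.
Qed.

(** Jacobi's formula.  The derivative is the sum over i of the determinants of P
    with row i replaced by row i of B P; expanding along this row gives
    tr (B P adj P). *)
Lemma is_derive_det n (P : V -> 'M[R]_n) x v (B : 'M[R]_n) :
  is_derive x v P (B *m P x) ->
  is_derive x v (fun y => \det (P y) : R^o) (\tr B * \det (P x)).
Proof.
move=> /is_derive_mxP dP; set Q := B *m P x.
have step : is_derive x v (fun y => \det (P y) : R^o)
   (\sum_(s : 'S_n) (-1) ^+ s *
      \sum_i \prod_j (if j == i then Q j (s j) else P x j (s j))).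
  apply: is_derive_bigsum => s.
  apply: is_deriveZ; apply: (is_derive_bigprod (F := fun j y => P y j (s j))
    (d := fun j => Q j (s j)) (index_enum_uniq _)).
apply: is_derive_eq step _.
under eq_bigr do rewrite mulr_sumr.
rewrite exchange_big /=.
transitivity (\tr (Q *m \adj (P x))); last first.
  by rewrite -mulmxA mul_mx_adj mul_mx_scalar mxtraceZ mulrC.
apply: eq_bigr => i _.
pose Pi := \matrix_(j, k) (if j == i then Q j k else P x j k).
transitivity (\det Pi).
  by apply: eq_bigr => s _; congr (_ * _); apply: eq_bigr => j _; rewrite [RHS]mxE.
rewrite (expand_det_row _ i) [RHS]mxE; apply: eq_bigr => k _.
rewrite [Pi i k]mxE eqxx [(\adj _) _ _]mxE; congr (_ * _).
rewrite /cofactor; congr (_ * \det _).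
by apply/matrixP => a b; rewrite !mxE eq_sym (negPf (neq_lift _ _)).
Qed.

End determinant.

(** * The second derivative test *)
Section second_derivative_test.
Context (R : realType) (m : nat).

(** A is the gradient field of psi.  If the second derivative along v were
    positive, the first one, zero at x, would be positive shortly after x, and
    the mean value theorem would give a larger value of psi there. *)
Lemma second_derivative_at_max (U : set 'rV[R]_m) (psi : 'rV[R]_m -> R)
    (A : 'rV[R]_m -> 'cV[R]_m) x :
  open U -> U x ->
  (forall y v, U y -> is_derive y v (psi : _ -> R^o) ((v *m A y) 0 0)) ->
  (\forall y \near x, psi y <= psi x) ->
  A x = 0 /\ forall v d, is_derive x v A d -> (v *m d) 0 0 <= 0.
Proof.
move=> oU Ux dpsi psimax.
have nearU (v : 'rV[R]_m) : exists2 r : R, 0 < r &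
    forall t : R, `|t| < r -> U (t *: v + x) /\ psi (t *: v + x) <= psi x.
  have : \forall y \near x, U y /\ psi y <= psi x.
    by apply: filterI => //; exact: open_nbhs_nbhs.
  move=> /nbhs_ballP[r /= r0 rP].
  exists (r / (`|v| + 1)).
    by rewrite divr_gt0// ltr_pwDr.
  move=> t tr; apply: rP; rewrite -ball_normE /ball_ /= opprD addrCA subrr addr0.
  rewrite normrN normrZ; apply: le_lt_trans (_ : `|t| * (`|v| + 1) < _).
    by rewrite ler_wpM2l// lerDl.
  by rewrite -ltr_pdivlMr// ltr_pwDr.
have A0 (v : 'rV[R]_m) : (v *m A x) 0 0 = 0.
  have [r r0 rP] := nearU v.
  have dg (t : R) : `|t| < r -> is_derive t (1 : R) (fun s : R => psi (s *: v + x) : R^o)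
      ((v *m A (t *: v + x)) 0 0).
    by move=> /rP[Ut _]; apply/is_derive_line; exact: dpsi.
  have /derive1_at_max : - r <= r by rewrite ge0_cp// ltW.
  move=> /(_ (fun s : R => psi (s *: v + x)) 0).
  case.
  - by move=> t; rewrite in_itv /= -ltr_norml => /dg[].
  - by rewrite in_itv /= oppr_lt0 r0.
  - by move=> t; rewrite in_itv /= -ltr_norml => /rP[_]; rewrite scale0r add0r.
  have [] := dg 0; first by rewrite normr0.
  by rewrite scale0r add0r => _ -> _ ->.
split.
  apply/matrixP => i j; rewrite (ord1 j) [RHS]mxE -(A0 (basis R i)) /basis.
  by rewrite -rowE mxE.
move=> v d dA; rewrite leNgt; apply/negP => L0.
have [r r0 rP] := nearU v.
have /is_derive_mxP/(_ 0 0) [cvL eqL] := is_derive_mulmxl v dA.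
have : \forall h \near (0 : R)^', 0 < h^-1 * (v *m A (h *: v + x)) 0 0.
  move: L0; rewrite -eqL => L0.
  have := @cvgr_gt _ _ (0 : R)^' _ _ _ cvL _ L0 => {}L0.
  near=> h; have : 0 < h^-1 * ((v *m A (h *: v + x)) 0 0 - (v *m A x) 0 0).
    by near: h; exact: L0.
  by rewrite A0 subr0.
move=> /nbhs_ballP[e /= e0 eP].
pose h := Num.min (r / 2) (e / 2).
have h0 : 0 < h by rewrite lt_min !divr_gt0.
have hr : h < r by rewrite gt_min ltr_pdivrMr// ltr_pMr// ltr1n.
have he : h < e by rewrite gt_min [X in _ || X]ltr_pdivrMr// ltr_pMr// ltr1n orbT.
have habs (t : R) : 0 <= t <= 1 -> `|t * h| <= h.
  by move=> /andP[t0 t1]; rewrite normrM (gtr0_norm h0) ger0_norm// ler_piMl// ltW.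
have [|t /andP[t0 t1]] := @MVT_line R _ psi x v h.
  move=> t t01; have [|//] := @dpsi ((t * h) *: v + x) v.
  by apply: (rP _ _).1; exact: le_lt_trans (habs _ t01) hr.
have t01 : 0 <= t <= 1 by rewrite (ltW t0) (ltW t1).
have th0 : 0 < t * h by rewrite mulr_gt0.
have [|_ ->] := @dpsi ((t * h) *: v + x) v.
  by apply: (rP _ _).1; exact: le_lt_trans (habs _ t01) hr.
have := eP (t * h).
rewrite /ball /= sub0r normrN => /(_ (le_lt_trans (habs _ t01) he)).
rewrite gt_eqF// => /(_ isT).
rewrite pmulr_rgt0 ?invr_gt0// => pos.
have [|_ lemax] := rP h; first by rewrite gtr0_norm.
by move=> E; have := mulr_gt0 h0 pos; rewrite -E subr_gt0 ltNge lemax.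
Unshelve. all: by end_near. Qed.

End second_derivative_test.

(** * Limits and C1 functions with values in matrices *)
Section matrix_limits.
Context (R : realType) (T : Type) (F : set_system T) {FF : Filter F}.

Lemma cvg_mx p q (f : T -> 'M[R]_(p, q)) (M : 'M[R]_(p, q)) :
  (forall i j, f t i j @[t --> F] --> M i j) -> f @ F --> M.
Proof.
move=> fM; apply/cvg_ballP => e e0; near=> t; split=> // i j.
move: i j; near: t; apply: filter_forall => i; apply: filter_forall => j.
by have /cvg_ballP := fM i j; apply.
Unshelve. all: by end_near. Qed.

Lemma cvg_coord p q (f : T -> 'M[R]_(p, q)) (M : 'M[R]_(p, q)) i j :
  f @ F --> M -> f t i j @[t --> F] --> M i j.
Proof. by move=> fM; exact: (cvg_comp _ _ fM (@coord_continuous _ _ _ i j _)). Qed.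

Lemma cvg_bigsum (I : Type) (s : seq I) (W : normedModType R) (f : I -> T -> W)
    (l : I -> W) :
  (forall i, f i @ F --> l i) ->
  (\sum_(i <- s) f i t) @[t --> F] --> \sum_(i <- s) l i.
Proof.
move=> fl; elim: s => [|i s IHs].
  by under eq_fun do rewrite big_nil; rewrite big_nil; exact: cvg_cst.
by under eq_fun do rewrite big_cons; rewrite big_cons; exact: cvgD.
Qed.

Lemma cvg_bigprod (I : Type) (s : seq I) (f : I -> T -> R) (l : I -> R) :
  (forall i, f i @ F --> l i) ->
  (\prod_(i <- s) f i t) @[t --> F] --> \prod_(i <- s) l i.
Proof.
move=> fl; elim: s => [|i s IHs].
  by under eq_fun do rewrite big_nil; rewrite big_nil; exact: cvg_cst.
by under eq_fun do rewrite big_cons; rewrite big_cons; exact: cvgM.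
Qed.

Lemma cvg_mulmx p q r (A : T -> 'M[R]_(p, q)) (B : T -> 'M[R]_(q, r))
    (a : 'M[R]_(p, q)) (b : 'M[R]_(q, r)) :
  A @ F --> a -> B @ F --> b -> (A t *m B t) @[t --> F] --> a *m b.
Proof.
move=> Aa Bb; apply: cvg_mx => i j.
under eq_fun do rewrite mxE.
by rewrite mxE; apply: cvg_bigsum => k; apply: cvgM; exact: cvg_coord.
Qed.

Lemma cvg_trmx p q (A : T -> 'M[R]_(p, q)) (a : 'M[R]_(p, q)) :
  A @ F --> a -> (A t)^T @[t --> F] --> a^T.
Proof.
move=> Aa; apply: cvg_mx => i j.
by under eq_fun do rewrite mxE; rewrite mxE; exact: cvg_coord.
Qed.

Lemma cvg_det n (A : T -> 'M[R]_n) (a : 'M[R]_n) :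
  A @ F --> a -> \det (A t) @[t --> F] --> \det a.
Proof.
move=> Aa; apply: cvg_bigsum => s; apply: cvgM; first exact: cvg_cst.
by apply: cvg_bigprod => i; exact: cvg_coord.
Qed.

End matrix_limits.

Section matrix_valued.
Context (R : realType) (m p q : nat).
Implicit Types (U : set 'rV[R]_m) (G : 'rV[R]_m -> 'M[R]_(p, q)).

(** For matrix values the Jacobian is not a matrix; the chain rule is stated with
    the partial derivatives instead. *)
Lemma is_derive_comp_mx (V : normedModType R) U G (phi : V -> 'rV[R]_m) x v d :
  open U -> U (phi x) -> C1_on U G -> is_derive x v phi d ->
  is_derive x v (G \o phi) (\sum_i d 0 i *: 'D_(basis R i) G (phi x)).
Proof.
move=> oU Ux CG /is_derive_line0 dphi; apply/is_derive_mxP => i j.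
apply/is_derive_line0.
have Ux0 : U (phi (0 *: v + x)) by rewrite scale0r add0r.
have := is_derive_comp_C1 oU Ux0 (C1_on_coord i j oU CG) dphi.
rewrite scale0r add0r => /is_derive_eq; apply.
rewrite summxE; apply: eq_bigr => k _; rewrite mxE derive_coord//.
by have [] := CG _ Ux k.
Qed.

Lemma C1_on_mx U G : open U ->
  (forall i j, C1_on U (fun y => G y i j : R^o)) -> C1_on U G.
Proof.
move=> oU CG x Ux k.
have dG y : U y -> derivable G y (basis R k).
  by move=> Uy; apply/derivable_mxP => i j; have [] := CG i j y Uy k.
split; first exact: dG.
suff cD i j : ('D_(basis R k) G y) i j @[y --> x] --> ('D_(basis R k) G x) i j.
  exact: (cvg_mx cD).
have [_] := CG i j x Ux k.
rewrite /prop_for /continuous_at derive_coord; last exact: dG.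
apply: cvg_trans; apply: (@near_eq_cvg _ _ (nbhs x)); near=> y.
by rewrite derive_coord//; apply: dG; near: y; exact: open_nbhs_nbhs.
Unshelve. all: by end_near. Qed.

Lemma derive_C1 U G x v : open U -> U x -> C1_on U G ->
  derivable G x v /\ 'D_v G x = \sum_i v 0 i *: 'D_(basis R i) G x.
Proof.
by move=> oU Ux CG; have [] := is_derive_comp_mx oU Ux CG (is_derive_id x v).
Qed.

End matrix_valued.

(** * The Hessian and the Laplacian *)
Section christoffel.
Context (R : realType) (m : nat).

Lemma christoffel_basis (C : connection R m) x j l :
  christoffel C x (basis R j) (basis R l) = C x j l.
Proof.
rewrite /christoffel (bigD1 j)//= (bigD1 l)//= !mxE !eqxx mulr1 scale1r.
rewrite !big1 ?addr0// => i ij; rewrite ?mxE ?eqxx ?(negPf ij) ?mulr0 ?scale0r//.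
by rewrite big1// => k _; rewrite mul0r scale0r.
Qed.

Lemma christoffel_flat x v w : christoffel (flat : connection R m) x v w = 0.
Proof. by rewrite /christoffel big1// => i _; rewrite big1// => j _; rewrite scaler0. Qed.

End christoffel.

Section second_order.
Context (R : realType) (m n : nat).
Implicit Types (U : set 'rV[R]_m) (F : 'rV[R]_m -> 'rV[R]_n).

Definition C2_on U F := C1_on U F /\ forall i, C1_on U ('D_(basis R i) F).

Lemma smooth_on_C2 U F : smooth_on U F -> C2_on U F.
Proof.
move=> sF; split; first exact: (smooth_on_C1 [::] sF).
by move=> i; exact: (smooth_on_C1 [:: i] sF).
Qed.

Lemma C1_on_jacobi U F : open U -> C2_on U F -> C1_on U (jacobi F).
Proof.
move=> oU [_ C2F]; apply: (C1_on_mx oU) => a b.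
under eq_fun do rewrite mxE.
exact: (C1_on_coord _ _ oU (C2F a)).
Qed.

(** The components of the covariant Hessian: the second derivative D_v D_w F for
    constant v and w, minus the derivative of F along nabla_v w. *)
Definition hessian F (C : connection R m) x v w : 'rV[R]_n :=
  w *m 'D_v (jacobi F) x - christoffel C x v w *m jacobi F x.

Lemma hessian_bilinear U F C x v w : open U -> U x -> C2_on U F ->
  hessian F C x v w =
  \sum_j \sum_l (v 0 j * w 0 l) *: hessian F C x (basis R j) (basis R l).
Proof.
move=> oU Ux C2F.
rewrite /hessian; under eq_bigr do under eq_bigr do rewrite scalerBr christoffel_basis.
under eq_bigr do rewrite sumrB.
rewrite sumrB; congr (_ - _).
  rewrite (derive_C1 v oU Ux (C1_on_jacobi oU C2F)).2 mulmx_sumr.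
  apply: eq_bigr => j _; rewrite -scalemxAr {1}(rV_basis w) mulmx_suml scaler_sumr.
  by apply: eq_bigr => l _; rewrite -scalemxAl scalerA.
rewrite mulmx_suml; apply: eq_bigr => j _; rewrite mulmx_suml.
by apply: eq_bigr => l _; rewrite scalemxAl.
Qed.

End second_order.

Section laplacian.
Context (R : realType) (m n : nat).
Implicit Types (U : set 'rV[R]_m) (F V : 'rV[R]_m -> 'rV[R]_n).

Lemma nabla_along_flat F X V x : nabla_along F flat X V x = 'D_(X x) V x.
Proof. by rewrite /nabla_along christoffel_flat addr0. Qed.

(** The derivatives of the frame itself, which occur both in
    nabla_e nabla_e V and in nabla_{nabla_e e} V, cancel. *)
Lemma laplacian_hessian U F V C e x : open U -> U x -> C2_on U V ->
  (forall i, C1_on U (e i)) ->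
  laplacian F C flat e V x = \sum_i hessian V C x (e i x) (e i x).
Proof.
move=> oU Ux C2V Ce; apply: eq_bigr => i _.
rewrite !nabla_along_flat /nabla.
have [CV _] := C2V.
have dJ w := derivableP (derive_C1 w oU Ux (C1_on_jacobi oU C2V)).1.
have de := derivableP (derive_C1 (e i x) oU Ux (Ce i)).1.
have -> : 'D_(e i x) (nabla_along F flat (e i) V) x =
    'D_(e i x) (e i) x *m jacobi V x + e i x *m 'D_(e i x) (jacobi V) x.
  have [_ <-] := is_derive_mulmx de (dJ (e i x)).
  apply: near_eq_derive; near=> y; rewrite nabla_along_flat.
  have Uy : U y by near: y; exact: open_nbhs_nbhs.
  by have [_ ->] := is_derive_C1 (e i y) oU Uy CV.
have [_ ->] := is_derive_C1 ('D_(e i x) (e i) x + christoffel C x (e i x) (e i x)) oU Ux CV.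
by rewrite mulmxDl opprD addrACA subrr add0r.
Unshelve. all: by end_near. Qed.

Lemma is_derive_jacobi_comp U O F (phi : 'rV[R]_m -> 'rV[R]_m) x v :
  open U -> open O -> O x ->
  (forall y, O y -> U (phi y)) -> C2_on U F -> C2_on O phi ->
  is_derive x v (jacobi (F \o phi))
    ('D_v (jacobi phi) x *m jacobi F (phi x)
      + jacobi phi x *m 'D_(v *m jacobi phi x) (jacobi F) (phi x)).
Proof.
move=> oU oO Ox OU C2F C2phi; have [CF _] := C2F; have [Cphi _] := C2phi.
have dphi y w : O y -> is_derive y w phi (w *m jacobi phi y).
  by move=> Oy; exact: is_derive_C1 oO Oy Cphi.
have dJF := is_derive_comp_mx oU (OU _ Ox) (C1_on_jacobi oU C2F) (dphi x v Ox).
rewrite -(derive_C1 _ oU (OU _ Ox) (C1_on_jacobi oU C2F)).2 in dJF.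
have dJphi := derivableP (derive_C1 v oO Ox (C1_on_jacobi oO C2phi)).1.
apply: near_eq_is_derive (is_derive_mulmx dJphi dJF); near=> y.
have Oy : O y by near: y; exact: open_nbhs_nbhs.
apply/matrixP => i a; rewrite [RHS]mxE.
have [_ ->] := is_derive_comp oU (OU _ Oy) CF (dphi y (basis R i) Oy).
by rewrite -mulmxA -rowE [RHS]mxE.
Unshelve. all: by end_near. Qed.

(** The Hessian is a tensor.  Here phi is a change of coordinates and Ck, Cl are
    the expressions of one connection; the second derivatives of phi that appear
    when F \o phi is differentiated twice are those in the transformation rule of
    the Christoffel symbols. *)
Lemma hessian_comp U O F (phi : 'rV[R]_m -> 'rV[R]_m) (Ck Cl : connection R m)
    x v w :
  open U -> open O -> O x ->
  (forall y, O y -> U (phi y)) -> C2_on U F -> C2_on O phi ->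
  push phi (nabla Ck (const v) (const w)) x =
    nabla_along phi Cl (const v) (push phi (const w)) x ->
  hessian (F \o phi) Ck x v w =
  hessian F Cl (phi x) (v *m jacobi phi x) (w *m jacobi phi x).
Proof.
move=> oU oO Ox OU C2F C2phi.
have [CF _] := C2F; have [Cphi _] := C2phi.
have dphi y u : O y -> 'D_u phi y = u *m jacobi phi y.
  by move=> Oy; have [] := is_derive_C1 u oO Oy Cphi.
move=> E0; have E : christoffel Ck x v w *m jacobi phi x = w *m 'D_v (jacobi phi) x
    + christoffel Cl (phi x) (v *m jacobi phi x) (w *m jacobi phi x).
  transitivity (push phi (nabla Ck (const v) (const w)) x).
    by rewrite /push dphi// /nabla derive_cst add0r.
  rewrite E0 /nabla_along; congr (_ + christoffel _ _ _ _); last 2 first.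
  - exact: dphi.
  - exact: dphi.
  have dJ := derivableP (derive_C1 v oO Ox (C1_on_jacobi oO C2phi)).1.
  have [_ <-] := is_derive_mulmxl w dJ; apply: near_eq_derive; near=> y.
  by apply: dphi; near: y; exact: open_nbhs_nbhs.
rewrite /hessian; have [_ ->] := is_derive_jacobi_comp v oU oO Ox OU C2F C2phi.
have -> : jacobi (F \o phi) x = jacobi phi x *m jacobi F (phi x).
  apply/matrixP => i a; rewrite [LHS]mxE.
  have [_ ->] := is_derive_comp oU (OU _ Ox) CF (is_derive_C1 (basis R i) oO Ox Cphi).
  by rewrite -mulmxA -rowE [LHS]mxE.
by rewrite mulmxDr !mulmxA E mulmxDl opprD addrACA subrr add0r.
Unshelve. all: by end_near. Qed.

End laplacian.

(** * Orthonormal frames and the Tchebychev field *)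
Section orthonormal_frames.
Context (R : realType) (m : nat).

Lemma frame_gram (G : 'M[R]_m) (e : 'I_m -> 'rV[R]_m) (E := \matrix_i e i) :
  (forall i j, ip G (e i) (e j) = (i == j)%:R) -> E *m G *m E^T = 1%:M.
Proof.
move=> oe; apply/matrixP => i j; rewrite [RHS]mxE -oe /ip !mxE.
apply: eq_bigr => k _; rewrite !mxE; congr (_ * _).
by apply: eq_bigr => l _; rewrite !mxE.
Qed.

Lemma frame_det_gt0 (G : 'M[R]_m) (e : 'I_m -> 'rV[R]_m) :
  (forall i j, ip G (e i) (e j) = (i == j)%:R) -> 0 < \det G.
Proof.
move=> /frame_gram /(congr1 determinant); rewrite !det_mulmx det_tr det1 => E.
have : 0 < \det (\matrix_i e i) ^+ 2 * \det G by rewrite expr2 mulrAC E.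
rewrite pmulr_rgt0// exprn_even_gt0//=; apply/eqP => d0.
by move/eqP: E; rewrite d0 mul0r mul0r eq_sym oner_eq0.
Qed.

(** The trace of a bilinear expression over an orthonormal frame is a contraction
    with the inverse metric, so it does not depend on the frame. *)
Lemma frame_trace (G : 'M[R]_m) (e : 'I_m -> 'rV[R]_m) (W : lmodType R)
    (H : 'I_m -> 'I_m -> W) :
  (forall i j, ip G (e i) (e j) = (i == j)%:R) ->
  \sum_i \sum_j \sum_l (e i 0 j * e i 0 l) *: H j l =
  \sum_j \sum_l invmx G j l *: H j l.
Proof.
move=> oe; have := frame_gram oe; set E := \matrix_i _ => EG.
have Gu : G \in unitmx by rewrite unitmxE unitfE gt_eqF// (frame_det_gt0 oe).
have -> : invmx G = E^T *m E.
  have /mulmx1C := EG; rewrite mulmxA => /(congr1 (mulmx^~ (invmx G))).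
  by rewrite mul1mx -!mulmxA mulmxV// mulmx1.
rewrite exchange_big; apply: eq_bigr => j _; rewrite exchange_big.
apply: eq_bigr => l _; rewrite -scaler_suml; congr (_ *: _).
by rewrite mxE; apply: eq_bigr => i _; rewrite !mxE.
Qed.

End orthonormal_frames.

Section coordinates.
Context (R : realType) (m : nat).
Implicit Types (U : set 'rV[R]_m) (G : 'M[R]_m) (C : connection R m).

Lemma ip_basisr G v k : ip G v (basis R k) = (v *m G) 0 k.
Proof. by rewrite /ip trmx_delta -colE mxE. Qed.

Lemma ip_basis G j k : ip G (basis R j) (basis R k) = G j k.
Proof. by rewrite ip_basisr -rowE mxE. Qed.

Lemma smooth_on_const (W : normedModType R) U (w : W) :
  smooth_on U (fun _ : 'rV[R]_m => w).
Proof.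
move=> s x _; have [w' ->] : exists w', iter_partial s (fun=> w) = cst w'.
  elim: s => [|i s [w' /= ->]]; first by exists w.
  by exists 0; apply/funext => y; rewrite derive_cst.
by split=> [|i]; [exact: cst_continuous|exact: derivable_cst].
Qed.

Lemma smooth_on_derivable (W : normedModType R) U (F : 'rV[R]_m -> W) x k :
  smooth_on U F -> U x -> derivable F x (basis R k).
Proof. by move=> sF Ux; exact: (sF [::] x Ux).2. Qed.

(** By the Codazzi equation and the absence of torsion, the difference tensor with
    its last index lowered, K_abc, is -1/2 (nabla_c g)_ab, hence totally
    symmetric.  So the components of tr_g K are, up to the factor -1/2,
    tr (g^-1 d_c g) - 2 Gamma_ca^a: they measure the failure of the Riemannian
    volume form to be parallel for nabla. *)
Lemma tchebychev_trace U (G : metric_field R m) C e x :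
  open U -> U x -> statistical_on U G C -> orthonormal_frame_on U G e ->
  (forall c, \tr (invmx (G x) *m 'D_(basis R c) G x)
             = 2 * \tr (\matrix_a C x c a)) ->
  tchebychev G C e x = 0.
Proof.
move=> oU Ux [[sG Gpos] _ tf cod] [_ oe] trE.
have Gu : G x \in unitmx by rewrite unitmxE unitfE gt_eqF// (frame_det_gt0 (oe x Ux)).
have symG y a b : U y -> G y a b = G y b a.
  by move=> Uy; rewrite -!ip_basis (Gpos y Uy).1.
have GT : (G x)^T = G x by apply/matrixP => a b; rewrite mxE symG.
have dG k : derivable G x (basis R k) by exact: smooth_on_derivable sG Ux.
(* dg a b c is d_a g_bc, and gl a b c is g(nabla_a d_b, d_c). *)
pose dg a b c := ('D_(basis R a) G x) b c.
have dmetricE a b c : dmetric G x (basis R a) (basis R b) (basis R c) = dg a b c.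
  rewrite /dmetric; under eq_fun do rewrite ip_basis.
  exact: derive_coord.
have dgC a b c : dg a b c = dg a c b.
  rewrite /dg -!derive_coord//; apply: near_eq_derive; near=> y.
  by apply: symG; near: y; exact: open_nbhs_nbhs.
pose gl a b c := ip (G x) (C x a b) (basis R c).
have glC a b c : gl a b c = gl b a c.
  by rewrite /gl -!christoffel_basis (tf x Ux).
have codE a b c : dg a b c - gl a b c - gl a c b = dg b a c - gl b a c - gl b c a.
  have := cod x Ux (basis R a) (basis R b) (basis R c).
  rewrite /nabla_metric !dmetricE !christoffel_basis.
  by rewrite ![ip (G x) (basis R _) _](Gpos x Ux).1.
have KE a b c : gl a b c - ip (G x) (levi_civita G x a b) (basis R c) =
    - 2^-1 * (dg c a b - gl c a b - gl c b a).
  rewrite sharpE// !dmetricE.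
  have := codE a b c; have := codE a c b; have := codE b c a.
  have := dgC a b c; have := dgC b a c; have := dgC c a b.
  have := glC a b c; have := glC a c b; have := glC b c a.
  by lra.
suff TG c : (tchebychev G C e x *m G x) 0 c = 0.
  have : tchebychev G C e x *m G x = 0.
    by apply/matrixP => i c; rewrite (ord1 i) TG mxE.
  by move=> /(congr1 (mulmx^~ (invmx (G x)))); rewrite mulmxK// mul0mx.
have -> : (tchebychev G C e x *m G x) 0 c =
   \sum_i \sum_a \sum_b (e i x 0 a * e i x 0 b) *:
      (- 2^-1 * (dg c a b - gl c a b - gl c b a) : R^o).
  rewrite /tchebychev mulmx_suml summxE; apply: eq_bigr => i _.
  rewrite /difference /christoffel -sumrB mulmx_suml summxE; apply: eq_bigr => a _.
  rewrite -sumrB mulmx_suml summxE; apply: eq_bigr => b _.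
  by rewrite -scalerBr -scalemxAl mxE mulmxBl !mxE -KE /gl !ip_basisr !mxE.
rewrite (frame_trace _ (oe x Ux)).
have IT : (invmx (G x))^T = invmx (G x) by rewrite trmx_inv GT.
pose S (N : 'M[R]_m) := \sum_a \sum_b invmx (G x) a b * N a b.
have SE N : S N = \tr (invmx (G x) *m N).
  rewrite /S exchange_big; apply: eq_bigr => b _; rewrite mxE; apply: eq_bigr => a _.
  by rewrite -{1}IT mxE.
have -> : \sum_j \sum_l invmx (G x) j l *:
     (- 2^-1 * (dg c j l - gl c j l - gl c l j) : R^o) =
   - 2^-1 * (S ('D_(basis R c) G x) - S ((\matrix_a C x c a) *m G x)
             - S ((\matrix_a C x c a) *m G x)^T).
  rewrite /S -!sumrB mulr_sumr; apply: eq_bigr => a _.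
  rewrite -!sumrB mulr_sumr; apply: eq_bigr => b _.
  rewrite -!mulrBr mulrCA /GRing.scale /=; congr (_ * (_ * (_ - _ - _))).
    by rewrite /gl ip_basisr !mxE; apply: eq_bigr => k _; rewrite !mxE.
  by rewrite mxE /gl ip_basisr !mxE; apply: eq_bigr => k _; rewrite !mxE.
rewrite !SE trE trmx_mul GT mulKmx// mxtrace_tr.
rewrite [\tr (invmx (G x) *m (_ *m _))]mxtrace_mulC -mulmxA mulmxV// mulmx1.
by rewrite [2]/(1 + 1) mulrDl mul1r -addrA -opprD subrr mulr0.
Unshelve. all: by end_near. Qed.

End coordinates.

(** * Improper affine spheres in a chart *)
Section improper_affine_sphere.
Context (R : realType) (m : nat) (U : set 'rV[R]_m).
Context (f xi : 'rV[R]_m -> 'rV[R]_m.+1) (G : metric_field R m) (C : connection R m).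
Context (oU : open U) (sf : smooth_on U f) (sxi : smooth_on U xi).
Context (gauss : forall X Y : vfield R m, smooth_on U X -> smooth_on U Y ->
  forall x, U x -> nabla_along f flat X (push f Y) x =
    push f (nabla C X Y) x + ip (G x) (X x) (Y x) *: xi x).
Context (weingarten : forall X : vfield R m, smooth_on U X ->
  forall x, U x -> nabla_along f flat X xi x = 0).

Let sconst (v : 'rV[R]_m) : smooth_on U (const v) := @smooth_on_const R m _ U v.

Let Cf : C1_on U f := (smooth_on_C2 sf).1.

Lemma is_derive_normal x v : U x -> is_derive x v xi 0.
Proof.
move=> Ux; rewrite -(weingarten (sconst v) Ux) nabla_along_flat.
exact: derivableP (derive_C1 v oU Ux (smooth_on_C2 sxi).1).1.
Qed.

Lemma push_jacobi X x : U x -> push f X x = X x *m jacobi f x.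
Proof. by move=> Ux; have [] := is_derive_C1 (X x) oU Ux Cf. Qed.

(** The Gauss formula for constant fields. *)
Lemma hessian_immersion x v w : U x ->
  hessian f C x v w = ip (G x) v w *: xi x.
Proof.
move=> Ux; have := gauss (sconst v) (sconst w) Ux.
rewrite nabla_along_flat push_jacobi// /nabla derive_cst add0r => E.
rewrite /hessian; apply/eqP; rewrite subr_eq addrC -E; apply/eqP.
have dJ := derivableP (derive_C1 v oU Ux (C1_on_jacobi oU (smooth_on_C2 sf))).1.
have [_ <-] := is_derive_mulmxl w dJ; apply: near_eq_derive; near=> y.
by rewrite push_jacobi//; near: y; exact: open_nbhs_nbhs.
Unshelve. all: by end_near. Qed.

Lemma tension_laplacian n (u : 'rV[R]_m -> 'rV[R]_n) e :
  tension u C flat e = laplacian u C flat e u.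
Proof.
have E X : nabla_along u flat X u = push u X.
  by apply/funext => y; rewrite nabla_along_flat.
apply/funext => x; rewrite /tension /laplacian.
by apply: eq_bigr => i _; rewrite !E.
Qed.

Lemma laplacian_immersion V e x : U x -> orthonormal_frame_on U G e ->
  laplacian V C flat e f x = m%:R *: xi x.
Proof.
move=> Ux [se oe]; rewrite (laplacian_hessian V C oU Ux (smooth_on_C2 sf)).
  rewrite (eq_bigr (fun _ => xi x)).
    by rewrite sumr_const card_ord scaler_nat.
  by move=> i _; rewrite hessian_immersion// oe// eqxx scale1r.
by move=> i; exact: (smooth_on_C2 (se i)).1.
Qed.

Lemma tension_immersion e x : U x -> orthonormal_frame_on U G e ->
  tension f C flat e x = m%:R *: xi x.
Proof. by move=> Ux oe; rewrite tension_laplacian laplacian_immersion. Qed.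

(** The rows are the coordinate vectors of the immersion followed by the affine
    normal, as in the condition on the volume forms of a Blaschke immersion. *)
Definition adapted_frame (x : 'rV[R]_m) : 'M[R]_m.+1 :=
  \matrix_(i < m.+1)
     if unlift ord_max i is Some j then 'D_(basis R j) f x else xi x.

(** B is the connection matrix of the frame: the Gauss formula gives its first m
    rows, and its last row is zero because xi is constant. *)
Lemma is_derive_adapted_frame x k (B : 'M[R]_m.+1 :=
    \matrix_(i, i') if unlift ord_max i is Some j then
      if unlift ord_max i' is Some l then C x k j 0 l else G x k j else 0) :
  U x -> is_derive x (basis R k) adapted_frame (B *m adapted_frame x).
Proof.
move=> Ux; apply/is_derive_mxP => i a.
rewrite mxE (bigD1_ord ord_max)//=.
under eq_bigr do rewrite [B _ _]mxE [adapted_frame _ _ _]mxE liftK.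
rewrite [B _ _]mxE [adapted_frame _ _ _]mxE unlift_none.
under eq_fun do rewrite mxE.
case: unliftP => [j _|_]; last first.
  rewrite mul0r add0r big1 => [|l _]; last by rewrite mul0r.
  by have /is_derive_mxP/(_ 0 a) := is_derive_normal (basis R k) Ux; rewrite mxE.
have dJ := derivableP (derive_C1 (basis R k) oU Ux
   (C1_on_jacobi oU (smooth_on_C2 sf))).1.
have /is_derive_mxP/(_ j a) := dJ.
under eq_fun do rewrite mxE.
move=> /is_derive_eq; apply.
have := hessian_immersion (basis R k) (basis R j) Ux.
rewrite /hessian christoffel_basis ip_basis -rowE => /eqP.
rewrite subr_eq => /eqP /rowP/(_ a).
rewrite !mxE => ->; congr (_ + _).
by apply: eq_bigr => l _; rewrite mxE.
Qed.

Context (st : statistical_on U G C).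
Context (e : 'I_m -> vfield R m) (oe : orthonormal_frame_on U G e).
Context (normal : forall x, U x ->
  `| \det (adapted_frame x) | = Num.sqrt (\det (G x))).

(** Jacobi's formula is applied to both sides of det g = det (adapted_frame)^2;
    the connection matrix of the adapted frame has the trace of the Christoffel
    symbols as its trace. *)
Lemma tchebychev_immersion x : U x -> tchebychev G C e x = 0.
Proof.
move=> Ux; apply: (tchebychev_trace oU Ux st oe) => c.
have Gdet y : U y -> 0 < \det (G y) by move=> /oe.2/frame_det_gt0.
have Gu : G x \in unitmx by rewrite unitmxE unitfE gt_eqF// Gdet.
have detE y : U y -> \det (G y) = \det (adapted_frame y) * \det (adapted_frame y).
  by move=> Uy; rewrite -expr2 -real_normK ?num_real// normal// sqr_sqrtr// ltW// Gdet.
have [sG _ _ _] := st.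
have : is_derive x (basis R c) G
    (('D_(basis R c) G x *m invmx (G x)) *m G x).
  by rewrite mulmxKV//; exact: derivableP (smooth_on_derivable sG.1 Ux).
move=> /is_derive_det [_ d1].
have [d2 d3] := is_derive_det (is_derive_adapted_frame c Ux).
have : 'D_(basis R c) (fun y => \det (G y) : R^o) x =
       'D_(basis R c) ((fun y => \det (adapted_frame y))
         * (fun y => \det (adapted_frame y)) : _ -> R^o) x.
  by apply: near_eq_derive; near do rewrite detE//; exact: open_nbhs_nbhs.
rewrite d1 deriveM// d3 /GRing.scale /= mulrCA -detE// -mulr2n -mulrnAl.
move=> /(mulIf (lt0r_neq0 (Gdet x Ux))).
rewrite mxtrace_mulC => ->; rewrite mulr_natl; congr (_ *+ 2).
rewrite /mxtrace (bigD1_ord ord_max)//= mxE unlift_none add0r.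
by apply: eq_bigr => j _; rewrite !mxE liftK.
Unshelve. all: by end_near. Qed.

End improper_affine_sphere.

(** * Maps into a flat Euclidean space *)
Section flat_target.
Context (R : realType) (n : nat) (h : metric_field R n) (hE : euclidean_metric h).

(** A metric that is parallel for the flat connection has constant coefficients,
    so its Levi-Civita connection and the conjugate connection are flat too, and
    every term of the bitension field and of the stability integral that comes
    from the geometry of the target vanishes. *)
Lemma dmetric_euclidean x v w z : dmetric h x v w z = 0.
Proof.
have := hE.2 x v w z; rewrite /nabla_metric !christoffel_flat.
by rewrite /ip mul0mx mul0mx trmx0 mulmx0 !mxE !subr0.
Qed.

Lemma sharp0 (G : 'M[R]_n) l : (forall k, l k = 0) -> sharp G l = 0.
Proof.
move=> l0; rewrite /sharp (_ : \row_k l k = 0) ?mul0mx//.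
by apply/rowP => k; rewrite !mxE.
Qed.

Lemma levi_civita_euclidean : levi_civita h = flat.
Proof.
apply/funext => x; apply/funext => i; apply/funext => j.
by apply: sharp0 => k; rewrite !dmetric_euclidean !(addr0, subr0) mulr0.
Qed.

Lemma conjugate_flat : conjugate h flat = flat.
Proof.
apply/funext => x; apply/funext => i; apply/funext => j.
apply: sharp0 => k; rewrite dmetric_euclidean /flat /ip !mul0mx mxE.
by rewrite subr0.
Qed.

Lemma difference_euclidean x v w : difference h flat x v w = 0.
Proof. by rewrite /difference levi_civita_euclidean subrr. Qed.

Lemma nabla_flat_const v (w : 'rV[R]_n) : nabla flat (const v) (const w) = const 0.
Proof. by apply/funext => x; rewrite /nabla christoffel_flat derive_cst addr0. Qed.

Lemma curvature_flat x v w z : curvature (flat : connection R n) x v w z = 0.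
Proof.
rewrite /curvature /curvature_op !nabla_flat_const.
by rewrite /nabla !christoffel_flat !derive_cst !(addr0, subr0).
Qed.

Lemma Ltensor_flat x v w z : Ltensor h flat x v w z = 0.
Proof.
by apply: sharp0 => k; rewrite curvature_flat /ip !mul0mx mxE.
Qed.

Lemma nabla_tensor2_eq0 (A : 'rV[R]_n -> 'rV[R]_n -> 'rV[R]_n -> 'rV[R]_n)
    x v a b :
  (forall y a b, A y a b = 0) -> nabla_tensor2 flat A x v a b = 0.
Proof.
move=> A0; rewrite /nabla_tensor2 !A0 /nabla christoffel_flat !(subr0, addr0).
by under eq_fun do rewrite A0; rewrite derive_cst.
Qed.

Lemma nabla_tensor3_eq0
    (A : 'rV[R]_n -> 'rV[R]_n -> 'rV[R]_n -> 'rV[R]_n -> 'rV[R]_n) x v a b c :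
  (forall y a b c, A y a b c = 0) -> nabla_tensor3 flat A x v a b c = 0.
Proof.
move=> A0; rewrite /nabla_tensor3 !A0 /nabla christoffel_flat !(subr0, addr0).
by under eq_fun do rewrite A0; rewrite derive_cst.
Qed.

Section maps.
Context (m : nat) (u : 'rV[R]_m -> 'rV[R]_n) (G : metric_field R m)
  (C : connection R m) (e : 'I_m -> vfield R m).

Lemma curlyH_flat V x : curlyH u G C h flat e V x = 0.
Proof.
rewrite /curlyH conjugate_flat curvature_flat.
rewrite nabla_tensor2_eq0; last by move=> *; exact: difference_euclidean.
rewrite !big1 ?(scaler0, addr0, subr0)// => i _.
- exact: Ltensor_flat.
- by apply: nabla_tensor3_eq0 => *; exact: Ltensor_flat.
- exact: curvature_flat.
- by apply: nabla_tensor3_eq0 => *; exact: curvature_flat.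
Qed.

Lemma jacobi_part_flat V x :
  jacobi_part u C h flat e V x = laplacian u C flat e V x.
Proof.
rewrite /jacobi_part difference_euclidean scaler0 subr0.
by rewrite big1 ?addr0// => i _; exact: curvature_flat.
Qed.

Lemma bitension_flat x :
  bitension u G C h flat e x =
  laplacian u (conjugate G C) flat e (tension u C flat e) x
  + divergence G (tchebychev G C e) x *: tension u C flat e x.
Proof.
rewrite /bitension conjugate_flat difference_euclidean subr0.
by rewrite big1 ?subr0// => i _; exact: Ltensor_flat.
Qed.

End maps.
End flat_target.

Section biharmonic.
Context (R : realType) (m n : nat) (U : set 'rV[R]_m) (oU : open U).

Lemma divergence_eq0 (G : metric_field R m) X x :
  U x -> (forall y, U y -> X y = 0) -> divergence G X x = 0.
Proof.
move=> Ux X0; rewrite /divergence big1// => i _.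
rewrite /nabla (derive_locally0 _ oU Ux X0) add0r X0// /christoffel.
by rewrite big1 ?mxE// => a _; rewrite big1// => b _; rewrite [X in _ * X]mxE mulr0 scale0r.
Qed.

Lemma laplacian_eq0 (u F : 'rV[R]_m -> 'rV[R]_n) C e x :
  U x -> (forall y v, U y -> 'D_v F y = 0) -> laplacian u C flat e F x = 0.
Proof.
move=> Ux F0; rewrite /laplacian big1// => i _.
rewrite !nabla_along_flat F0// subr0; apply: (derive_locally0 _ oU Ux) => y Uy.
by rewrite nabla_along_flat F0.
Qed.

End biharmonic.

(** * Positivity of integrals *)
Section boxes.
Import HBNNSimple.
Context (R : realType).

Definition box n (c : 'I_n -> R) (r : R) : set (n.-tuple R) :=
  [set t | forall i, ball (c i) r (tnth t i)].

Lemma measurable_box n (c : 'I_n -> R) r : measurable (box c r).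
Proof.
rewrite (_ : box c r = \bigcap_(i in [set: 'I_n]) ((fun t => tnth t i) @^-1` ball (c i) r)).
  apply: fin_bigcap_measurable => [|i _]; first exact: finite_finset.
  rewrite -[X in measurable X]setTI.
  by apply: measurable_tnth => //; exact: measurable_realfun.measurable_ball.
by apply/seteqP; split => t tb i; [move=> _|]; apply: tb.
Qed.

(** By induction on the dimension: a box is the product of an interval and a box
    of lower dimension. *)
Lemma lebesgue_tuple_box_gt0 n (c : 'I_n -> R) r : 0 < r ->
  (0 < lebesgue_tuple R n (box c r))%E.
Proof.
move=> r0; elim: n c => [|n IHn] c.
  by rewrite /= diracE mem_set ?lte01// => -[].
rewrite /= /product_step /pushforward.
rewrite (_ : _ @^-1` _ = ball (c ord0) r `*` box (fun i => c (lift ord0 i)) r).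
  rewrite product_measure1E; last 2 first.
  - exact: measurable_realfun.measurable_ball.
  - exact: measurable_box.
  apply: mule_gt0; last exact: IHn.
  by rewrite [ltRHS](lebesgue_measure_ball _ (ltW r0)) lte_fin mulrn_wgt0.
apply/seteqP; split => -[y t] /=.
  move=> yt; split; first exact: (yt ord0).
  by move=> i; have := yt (lift ord0 i); rewrite tnthS.
move=> [cy ct] i; have [j ->|->] := unliftP ord0 i; last by [].
by rewrite tnthS; exact: ct.
Qed.

(** The integral of a non-negative function is the supremum of the integrals of
    the simple functions below it, and c times the indicator function of B is one
    of these. *)
Lemma integral_gt0 d (T : measurableType d) (mu : {measure set T -> \bar R})
    (D B : set T) (F : T -> R) (c : R) :
  (forall t, D t -> 0 <= F t) -> B `<=` D -> measurable B -> (0 < mu B)%E ->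
  0 < c -> (forall t, B t -> c <= F t) ->
  (0 < \int[mu]_(t in D) (F t)%:E)%E.
Proof.
move=> F0 BD mB muB c0 cF.
rewrite ge0_integralE; last by move=> t Dt; rewrite lee_fin F0.
apply: (@lt_le_trans _ _ (c%:E * mu B)%E); first by rewrite mule_gt0.
apply: ereal_sup_ubound => /=.
exists (scale_nnsfun (indic_nnsfun R mB) (ltW c0)); last first.
  transitivity (sintegral mu (cst c \* indic_nnsfun R mB)); first by [].
  rewrite (sintegralrM mu c (indic_nnsfun R mB)); congr (_ * _)%E.
  exact: sintegral_indic.
move=> t; rewrite [X in (X%:E <= _)%E](_ : _ = c * \1_B t)// /patch indicE.
case: (boolP (t \in B)) => [tB|_].
  rewrite mem_set; last by apply: BD; exact: set_mem.
  by rewrite mulr1 lee_fin; apply: cF; exact: set_mem.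
rewrite mulr0; case: ifPn => // /set_mem Dt.
by rewrite lee_fin F0.
Qed.

(** Balls for the supremum norm on row vectors are boxes. *)
Lemma integral_rV_gt0 n (D : set 'rV[R]_n) (F : 'rV[R]_n -> R) x :
  (forall y, D y -> 0 <= F y) -> nbhs x D -> 0 < F x ->
  {for x, continuous F} -> (0 < integral_rV D F)%E.
Proof.
move=> F0 nD Fx cF.
have : \forall y \near x, D y /\ F x / 2 <= F y.
  apply: filterI => //; apply: (cvgr_ge _ cF).
  by rewrite ltr_pdivrMr// ltr_pMr// ltr1n.
move=> /nbhs_ballP[r /= r0 rP].
have boxP t : box (fun i => x 0 i) r t -> ball x r (rV_of_tuple t).
  by move=> tb; split=> // i j; rewrite (ord1 i) mxE; exact: tb.
apply: (@integral_gt0 _ _ _ _ (box (fun i => x 0 i) r) _ (F x / 2)).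
- by move=> t; exact: F0.
- by move=> t /boxP/rP[].
- exact: measurable_box.
- exact: lebesgue_tuple_box_gt0.
- by rewrite divr_gt0.
- by move=> t /boxP/rP[].
Qed.

Lemma integral_rV_ge0 n (D : set 'rV[R]_n) (F : 'rV[R]_n -> R) :
  (forall y, D y -> 0 <= F y) -> (0 <= integral_rV D F)%E.
Proof. by move=> F0; apply: integral_ge0 => t Dt; rewrite lee_fin F0. Qed.

End boxes.

(** * The Laplacian on a manifold *)
Section laplacian_continuity.
Context (R : realType) (m n : nat) (U : set 'rV[R]_m) (oU : open U).

Lemma eq_hessian (F F' : 'rV[R]_m -> 'rV[R]_n) C x v w : U x ->
  (forall y, U y -> F y = F' y) -> hessian F C x v w = hessian F' C x v w.
Proof.
move=> Ux FF'; have J y : U y -> jacobi F y = jacobi F' y.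
  move=> Uy; apply/matrixP => i a; rewrite !mxE; congr (fun_of_matrix _ 0 a).
  by apply: near_eq_derive; near do apply: FF'; exact: open_nbhs_nbhs.
have dJ : 'D_v (jacobi F) x = 'D_v (jacobi F') x.
  by apply: near_eq_derive; near do apply: J; exact: open_nbhs_nbhs.
by rewrite /hessian dJ (J x Ux).
Unshelve. all: by end_near. Qed.

(** Directional derivatives along the varying vectors e i y are not visibly
    continuous in y; the bilinear expansion of the Hessian replaces them by
    partial derivatives. *)
Lemma laplacian_continuous (u V : 'rV[R]_m -> 'rV[R]_n) C
    (e : 'I_m -> vfield R m) x :
  smooth_on U V -> (forall i j, smooth_on U (fun y => C y i j)) ->
  (forall i, smooth_on U (e i)) -> U x ->
  {for x, continuous (laplacian u C flat e V)}.
Proof.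
move=> sV sC se Ux.
have C2V := smooth_on_C2 sV.
have C1J := C1_on_jacobi oU C2V.
pose T i j l y := (e i y 0 j * e i y 0 l) *:
  (basis R l *m 'D_(basis R j) (jacobi V) y - C y j l *m jacobi V y).
pose L y := \sum_i \sum_j \sum_l T i j l y.
have LE y : U y -> laplacian u C flat e V y = L y.
  move=> Uy; rewrite (laplacian_hessian u C oU Uy C2V); last first.
    by move=> i; exact: (smooth_on_C2 (se i)).1.
  apply: eq_bigr => i _; rewrite (hessian_bilinear _ _ _ oU Uy C2V).
  by apply: eq_bigr => j _; apply: eq_bigr => l _; rewrite /hessian christoffel_basis.
have cL : L y @[y --> x] --> L x.
  have cJ : jacobi V y @[y --> x] --> jacobi V x.
    suff cij i a : jacobi V y i a @[y --> x] --> jacobi V x i a by exact: (cvg_mx cij).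
    have E : (fun y => jacobi V y i a) = (fun y => ('D_(basis R i) V y) 0 a).
      by apply/funext => y; rewrite mxE.
    by rewrite E mxE; apply: cvg_coord; exact: (sV [:: i] x Ux).1.
  have ce i j : e i y 0 j @[y --> x] --> e i x 0 j.
    by apply: cvg_coord; exact: (se i [::] x Ux).1.
  have cb (l : 'I_m) : basis R l @[_ --> x] --> basis R l.
    exact: (@cst_continuous _ _ (basis R l) x).
  have cD j := (C1J x Ux j).2.
  have cC j l := (sC j l [::] x Ux).1.
  have c0 j l : (basis R l *m 'D_(basis R j) (jacobi V) y - C y j l *m jacobi V y)
      @[y --> x] --> basis R l *m 'D_(basis R j) (jacobi V) x - C x j l *m jacobi V x.
    exact: (cvgB (cvg_mulmx (cb l) (cD j)) (cvg_mulmx (cC j l) cJ)).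
  have c1 i j l : T i j l @ x --> T i j l x.
    exact: (cvgZ (cvgM (ce i j) (ce i l)) (c0 j l)).
  have c2 i j : (\sum_l T i j l y) @[y --> x] --> \sum_l T i j l x.
    exact: (@cvg_bigsum R _ (nbhs x) _ _ _ 'rV[R]_n (T i j) _ (c1 i j)).
  have c3 i : (\sum_j \sum_l T i j l y) @[y --> x] --> \sum_j \sum_l T i j l x.
    exact: (@cvg_bigsum R _ (nbhs x) _ _ _ 'rV[R]_n
      (fun j y => \sum_l T i j l y) _ (c2 i)).
  exact: (@cvg_bigsum R _ (nbhs x) _ _ _ 'rV[R]_n
    (fun i y => \sum_j \sum_l T i j l y) _ c3).
have nL : \forall y \near x, L y = laplacian u C flat e V y.
  by near do rewrite LE//; exact: open_nbhs_nbhs.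
rewrite /prop_for /continuous_at LE//.
exact: cvg_trans (near_eq_cvg nL) cL.
Unshelve. all: by end_near. Qed.

End laplacian_continuity.

Section manifold.
Context (R : realType) (m : nat) (M : topologicalType).
Context (A : smooth_atlas R m M).

Lemma open_img k : open (img A k). Proof. exact: img_open. Qed.

Lemma mem_img k p : dom A k p -> img A k (chart A k p).
Proof. by move=> kp; exists p. Qed.

Lemma dom_param k x : img A k x -> dom A k (param A k x).
Proof. by move=> [p kp <-]; rewrite chartK. Qed.

Lemma paramK k x : img A k x -> chart A k (param A k x) = x.
Proof. by move=> [p kp <-]; rewrite chartK. Qed.

Definition overlap k l := chart A k @` (dom A k `&` dom A l).

Lemma overlapE k l : overlap k l = img A k `&` (param A k @^-1` dom A l).
Proof.
apply/seteqP; split=> x.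
  by move=> [p [kp lp] <-]; split; [exact: mem_img|rewrite /= chartK].
by move=> [kx lx]; exists (param A k x); [split => //; exact: dom_param|exact: paramK].
Qed.

Lemma open_preimage k (B : set M) :
  open B -> open (img A k `&` (param A k @^-1` B)).
Proof.
move=> oB; rewrite openE => x [kx Bx]; apply: filterI.
  by apply: open_nbhs_nbhs; split => //; exact: open_img.
by apply: (param_continuous kx); exact: open_nbhs_nbhs.
Qed.

Lemma open_overlap k l : open (overlap k l).
Proof. by rewrite overlapE; apply: open_preimage; exact: dom_open. Qed.

Lemma dom_coverP p : exists k, dom A k p.
Proof. by have : [set: M] p by []; rewrite -(dom_cover A) => -[k _ kp]; exists k. Qed.

Lemma smooth_map_continuous (W : normedModType R) (F : M -> W) :
  smooth_map A F -> continuous F.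
Proof.
move=> sF p; have [k kp] := dom_coverP p.
have cF := (sF k [::] _ (mem_img kp)).1.
have cc := chart_continuous kp.
have cFc : (F \o param A k) (chart A k q) @[q --> p] --> F p.
  rewrite -[X in _ --> F X](chartK kp).
  exact: (cvg_comp _ _ cc cF).
apply: cvg_trans cFc; apply: near_eq_cvg; near=> q.
rewrite /= chartK//; near: q.
by apply: open_nbhs_nbhs; split => //; exact: dom_open.
Unshelve. all: by end_near. Qed.

Section chart_independence.
Context (n : nat) (g : nat -> metric_field R m) (C : nat -> connection R m).
Context (stat : statistical A g C) (e : nat -> 'I_m -> vfield R m).
Context (oe : forall k, orthonormal_frame_on (img A k) (g k) (e k)).
Context (u V : M -> 'rV[R]_n) (sV : smooth_map A V).

Let C2V k : C2_on (img A k) (V \o param A k).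
Proof. by apply: smooth_on_C2; exact: sV. Qed.

Definition lap k := laplacian (u \o param A k) (C k) flat (e k) (V \o param A k).

Lemma lapE k x : img A k x ->
  lap k x = \sum_i hessian (V \o param A k) (C k) x (e k i x) (e k i x).
Proof.
move=> kx; rewrite /lap (laplacian_hessian _ _ (@open_img k) kx (C2V k))//.
by move=> i; exact: (smooth_on_C2 ((oe k).1 i)).1.
Qed.

(** The Hessian is a tensor, the connections are related by the transformation
    rule, and the two frames are orthonormal for the same metric. *)
Lemma lap_chart k l p : dom A k p -> dom A l p ->
  lap k (chart A k p) = lap l (chart A l p).
Proof.
move=> kp lp; set x := chart A k p; set phi := transition A k l.
have phix : phi x = chart A l p by rewrite /phi /transition /= chartK.
have Ox : overlap k l x by exists p.
have kx : img A k x := mem_img kp.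
have lx : img A l (chart A l p) := mem_img lp.
have OU y : overlap k l y -> img A l (phi y).
  by move=> [q [kq lq] <-]; rewrite /phi /transition /= chartK//; exact: mem_img.
have C2phi : C2_on (overlap k l) phi.
  by apply: smooth_on_C2; exact: transition_smooth.
have [_ trans] := stat.
rewrite (lapE kx) (lapE lx).
pose e' i := e k i x *m jacobi phi x.
have hessE v w : hessian (V \o param A k) (C k) x v w =
    hessian (V \o param A l) (C l) (chart A l p)
      (v *m jacobi phi x) (w *m jacobi phi x).
  have [_ E] := trans k l p kp lp v w.
  have := hessian_comp (@open_img l) (@open_overlap k l) Ox OU (C2V l) C2phi E.
  rewrite phix => <-; apply: (eq_hessian (@open_overlap k l)) => // y [q [kq lq] <-].
  by rewrite /phi /transition /= !chartK.
transitivity (\sum_i hessian (V \o param A l) (C l) (chart A l p) (e' i) (e' i)).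
  by apply: eq_bigr => i _; exact: hessE.
have oe' i j : ip (g l (chart A l p)) (e' i) (e' j) = (i == j)%:R.
  rewrite -((oe k).2 x kx) /e'.
  have [-> _] := trans k l p kp lp (e k i x) (e k j x).
  rewrite -/x -/phi phix; congr (ip _ _ _).
    by have [_ ->] := is_derive_C1 (e k i x) (@open_overlap k l) Ox C2phi.1.
  by have [_ ->] := is_derive_C1 (e k j x) (@open_overlap k l) Ox C2phi.1.
under eq_bigr do rewrite (hessian_bilinear _ _ _ (@open_img l) lx (C2V l)).
under [RHS]eq_bigr do rewrite (hessian_bilinear _ _ _ (@open_img l) lx (C2V l)).
by rewrite (frame_trace _ oe') (frame_trace _ ((oe l).2 _ lx)).
Qed.

End chart_independence.

End manifold.

(** * Sections with compact support are not harmonic *)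
Section row_vectors.
Context (R : realType).

Lemma dot_gt0 n (c : 'rV[R]_n) : c != 0 -> 0 < (c *m c^T) 0 0.
Proof.
move=> c0; rewrite mxE lt_def; apply/andP; split; last first.
  by apply: sumr_ge0 => i _; rewrite mxE -expr2 sqr_ge0.
apply: contra c0 => /eqP s0; apply/eqP/rowP => i; rewrite mxE.
move/eqP: s0; rewrite psumr_eq0 => [/allP/(_ i)|j _]; last first.
  by rewrite mxE -expr2 sqr_ge0.
by rewrite mem_index_enum mxE -expr2 sqrf_eq0 => /(_ isT)/eqP.
Qed.

Lemma sum_mulmx_coord n (I : Type) (s : seq I) (h h' : I -> 'rV[R]_n)
    (c c' : 'cV[R]_n) :
  ((\sum_(i <- s) h i) *m c + (\sum_(i <- s) h' i) *m c') 0 0 =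
  \sum_(i <- s) (h i *m c + h' i *m c') 0 0.
Proof. by rewrite !mulmx_suml -big_split summxE. Qed.

Lemma mulmx_pair p n (v w : 'rV[R]_p) (P P' Q Q' : 'M[R]_(p, n)) (c c' : 'cV[R]_n) :
  (v *m P - w *m Q) *m c + (v *m P' - w *m Q') *m c' =
  v *m (P *m c + P' *m c') - w *m (Q *m c + Q' *m c').
Proof. by rewrite !mulmxBl addrACA -opprD -!mulmxA -!mulmxDr. Qed.

End row_vectors.

Section stability.
Context (R : realType) (m : nat) (M : topologicalType) (A : smooth_atlas R m M).
Context (f xi : M -> 'rV[R]_(m.+1)) (g : nat -> metric_field R m)
  (C : nat -> connection R m) (S : nat -> 'rV[R]_m -> 'M[R]_m).
Context (m_gt0 : (0 < m)%N) (stat : statistical A g C)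
  (sphere : locally_convex_improper_affine_sphere A f xi g C S).

Let f_ k := f \o param A k.
Let xi_ k := xi \o param A k.
Let oimg k : open (img A k) := @open_img _ _ _ A k.

Lemma smooth_f k : smooth_on (img A k) (f_ k).
Proof. by have [[[sf _] _ _ _] _ _] := sphere; exact: sf. Qed.

Lemma smooth_xi k : smooth_on (img A k) (xi_ k).
Proof. by have [[_ [sxi _] _ _] _ _] := sphere; exact: sxi. Qed.

Lemma sphere_gauss k (X Y : vfield R m) :
  smooth_on (img A k) X -> smooth_on (img A k) Y ->
  forall x, img A k x -> nabla_along (f_ k) flat X (push (f_ k) Y) x =
    push (f_ k) (nabla (C k) X Y) x + ip (g k x) (X x) (Y x) *: xi_ k x.
Proof.
by move=> sX sY x kx; have [[_ _ gw _] _ _] := sphere; have [] := gw k X Y sX sY x kx.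
Qed.

Lemma sphere_weingarten k (X : vfield R m) : smooth_on (img A k) X ->
  forall x, img A k x -> nabla_along (f_ k) flat X (xi_ k) x = 0.
Proof.
move=> sX x kx; have [[_ _ gw _] _ S0] := sphere.
have [_ ->] := gw k X X sX sX x kx.
by rewrite /push (S0 k x kx) mulmx0 derive0 oppr0.
Qed.

Lemma sphere_normal k x : img A k x ->
  `| \det (adapted_frame (f_ k) (xi_ k) x) | = Num.sqrt (\det (g k x)).
Proof.
move=> kx; have [[_ _ _ an] _ _] := sphere.
rewrite (an k x kx (@basis R m)); congr (Num.sqrt (\det _)).
by apply/matrixP => i j; rewrite mxE ip_basis.
Qed.

Lemma sphere_normal_neq0 k x : img A k x -> xi_ k x != 0.
Proof.
move=> kx; have [[_ [_ tr] _ _] _ _] := sphere.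
by apply/eqP => xi0; apply: (tr k x kx 0); rewrite derive0 -/(xi_ k) xi0.
Qed.

(** Both remaining terms of the bitension field are zero: T vanishes on the whole
    chart, hence so does its divergence, and tau(f) = m xi is constant. *)
Lemma sphere_biharmonic (g0 : metric_field R m.+1) k (e : 'I_m -> vfield R m) x :
  euclidean_metric g0 -> orthonormal_frame_on (img A k) (g k) e ->
  img A k x -> bitension (f_ k) (g k) (C k) g0 flat e x = 0.
Proof.
move=> g0E oe kx; rewrite (bitension_flat g0E).
have [st _] := stat.
rewrite (divergence_eq0 (@oimg k) _ kx); last first.
  move=> y; exact: (tchebychev_immersion (@oimg k) (@smooth_f k) (@smooth_xi k)
    (@sphere_gauss k) (@sphere_weingarten k) (st k) oe (@sphere_normal k)).
rewrite scale0r addr0; apply: (laplacian_eq0 (@oimg k) _ _ _ kx) => y v ky.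
have tE z : img A k z -> m%:R *: xi_ k z = tension (f_ k) (C k) flat e z.
  move=> kz; apply: esym.
  exact: (tension_immersion (@oimg k) (@smooth_f k) (@sphere_gauss k) kz oe).
have [d1 d2] := is_derive_normal (@oimg k) (@smooth_xi k) (@sphere_weingarten k) v ky.
transitivity ('D_v (m%:R *: xi_ k) y).
  by apply/esym/near_eq_derive; near do apply: tE; exact: open_nbhs_nbhs.
by rewrite deriveZ// d2 scaler0.
Unshelve. all: by end_near. Qed.

Context (e : nat -> 'I_m -> vfield R m)
  (oe : forall k, orthonormal_frame_on (img A k) (g k) (e k)).

(** If Delta V vanished at a local maximum p of psi = <V, c> + eps <f, xi>, the
    Laplacian of psi at p would be eps m |xi|^2 > 0.  But the gradient of psi is
    zero at p and its Hessian is non-positive, which makes its Laplacian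
    non-positive whatever the connection is. *)
Lemma lap_neq0_at_max (u V : M -> 'rV[R]_m.+1) (c : 'rV[R]_m.+1) (eps : R) p
    (psi := fun q => (V q *m c^T) 0 0 + eps * (f q *m (xi q)^T) 0 0) k :
  smooth_map A V -> 0 < eps -> dom A k p ->
  (\forall q \near p, psi q <= psi p) ->
  lap A C e u V k (chart A k p) != 0.
Proof.
move=> sV eps0 kp psimax; apply/eqP => lap0.
set x := chart A k p; have kx : img A k x := mem_img kp.
pose Vk := V \o param A k.
have C2V : C2_on (img A k) Vk by apply: smooth_on_C2; exact: sV.
have C2f : C2_on (img A k) (f_ k) := smooth_on_C2 (@smooth_f k).
(* The gradient of psi; xi contributes nothing as it is constant. *)
pose a y : 'cV[R]_m :=
  jacobi Vk y *m c^T + jacobi (f_ k) y *m (eps *: (xi_ k y)^T).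
have dxi y v : img A k y -> is_derive y v (fun y => eps *: (xi_ k y)^T) 0.
  move=> ky; rewrite -(scaler0 _ eps) -(trmx0 R 1 m.+1).
  apply: is_deriveZ; apply: is_derive_trmx.
  exact: (is_derive_normal (@oimg k) (@smooth_xi k) (@sphere_weingarten k) v ky).
pose psik y := (Vk y *m c^T + f_ k y *m (eps *: (xi_ k y)^T)) 0 0.
have psikE y : psik y = psi (param A k y).
  by rewrite /psik /psi mxE -scalemxAr; congr (_ + _); rewrite [LHS]mxE.
have dpsi y v : img A k y -> is_derive y v (psik : _ -> R^o) ((v *m a y) 0 0).
  move=> ky.
  have dV := is_derive_C1 v (@oimg k) ky C2V.1.
  have df := is_derive_C1 v (@oimg k) ky C2f.1.
  have d2 := is_derive_mulmx df (dxi y v ky).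
  have /is_derive_mxP/(_ 0 0) := is_deriveD (is_derive_mulmxr c^T dV) d2.
  by rewrite mulmx0 addr0 /a mulmxDr !mulmxA.
have psimaxk : \forall y \near x, psik y <= psik x.
  have px : param A k x = p by exact: chartK.
  have := param_continuous kx; rewrite /prop_for /continuous_at px => /(_ _ psimax) H.
  by near do rewrite !psikE px; exact: H.
have [a0 alt] := second_derivative_at_max (@oimg k) kx dpsi psimaxk.
pose da v := 'D_v (jacobi Vk) x *m c^T
  + 'D_v (jacobi (f_ k)) x *m (eps *: (xi_ k x)^T).
have daP v : is_derive x v a (da v).
  have dV := derivableP (derive_C1 v (@oimg k) kx (C1_on_jacobi (@oimg k) C2V)).1.
  have df := derivableP (derive_C1 v (@oimg k) kx (C1_on_jacobi (@oimg k) C2f)).1.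
  have d2 := is_derive_mulmx df (dxi x v kx).
  rewrite (_ : _ + _ = 'D_v (jacobi (f_ k)) x *m (eps *: (xi_ k x)^T)) in d2.
    exact: (is_deriveD (is_derive_mulmxr c^T dV) d2).
  by rewrite mulmx0 addr0.
have lap_le0 : (lap A C e u V k x *m c^T
    + (m%:R *: xi_ k x) *m (eps *: (xi_ k x)^T)) 0 0 <= 0.
  have lf : laplacian Vk (C k) flat (e k) (f_ k) x = m%:R *: xi_ k x.
    exact: (laplacian_immersion (@oimg k) (@smooth_f k) (@sphere_gauss k) _ kx (oe k)).
  rewrite -lf (lapE C oe u sV kx) (laplacian_hessian _ _ (@oimg k) kx C2f); last first.
    by move=> i; exact: (smooth_on_C2 ((oe k).1 i)).1.
  rewrite sum_mulmx_coord; apply: sumr_le0 => i _.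
  by rewrite mulmx_pair -/(a x) a0 mulmx0 subr0; exact: alt (daP (e k i x)).
have := dot_gt0 (sphere_normal_neq0 kx).
move=> xi0; move: lap_le0; rewrite lap0 mul0mx add0r -scalemxAl -scalemxAr !mxE.
rewrite leNgt => /negP; apply.
rewrite !mulr_gt0//; first by rewrite ltr0n.
by rewrite mxE in xi0.
Unshelve. all: by end_near. Qed.

(** With c = V p0 and eps small compared with |c|^2 and with the oscillation of
    <f, xi> over the support, psi = <V, c> + eps <f, xi> is larger at p0 than at
    any zero of V in the support.  So its maximum over the support is attained
    where V is non-zero; near such a point the support is a neighbourhood, and
    the maximum is a local one. *)
Lemma exists_nonharmonic (u V : M -> 'rV[R]_m.+1) : smooth_map A V ->
  compact (closure [set p | V p != 0]) -> (exists p, V p != 0) ->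
  exists k p, [/\ dom A k p, V p != 0 & lap A C e u V k (chart A k p) != 0].
Proof.
move=> sV; set K := closure _ => cK [p0 Vp0].
have K0 : K p0 by exact: subset_closure.
have Kn : K !=set0 by exists p0.
have cV := smooth_map_continuous sV.
have [[[sf _] [sxi _] _ _] _ _] := sphere.
have cf := smooth_map_continuous sf.
have cxi := smooth_map_continuous sxi.
pose w q := (f q *m (xi q)^T) 0 0.
have cw : continuous w.
  by move=> q; apply: cvg_coord; apply: cvg_mulmx; [exact: cf|apply: cvg_trmx; exact: cxi].
have cwK := continuous_subspaceT cw.
have [pM _ wM] := compact_EVT_max Kn cK (cwK K).
have [pm _ wm] := compact_EVT_min Kn cK (cwK K).
pose c := V p0.
pose a := (c *m c^T) 0 0.
have a0 : 0 < a by exact: dot_gt0.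
have W0 : 0 <= w pM - w pm.
  by rewrite subr_ge0 (le_trans (wm p0 _) (wM p0 _))// mem_set.
(* Adding 1 keeps the denominator positive when w is constant on K. *)
pose eps := a / (w pM - w pm + 1).
have eps0 : 0 < eps by rewrite divr_gt0// ltr_wpDl.
have epsW : eps * (w pM - w pm) < a.
  by rewrite /eps mulrAC ltr_pdivrMr ?ltr_wpDl// ltr_pM2l// ltrDl.
pose psi q := (V q *m c^T) 0 0 + eps * w q.
have cpsi : continuous psi.
  move=> q; apply: cvgD; last by apply: cvgM; [exact: cvg_cst|exact: cw].
  by apply: cvg_coord; apply: cvg_mulmx; [exact: cV|exact: cvg_cst].
have [p1 /set_mem Kp1 psi1] := compact_EVT_max Kn cK (continuous_subspaceT cpsi).
have Vp1 : V p1 != 0.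
  apply/eqP => V1; have := psi1 p0 (mem_set K0).
  have -> : psi p0 = a + eps * w p0 by [].
  have -> : psi p1 = eps * w p1 by rewrite /psi V1 mul0mx mxE add0r.
  rewrite -lerBrDr -mulrBr leNgt => /negP; apply.
  apply: le_lt_trans epsW; apply: ler_wpM2l; first exact: ltW.
  by apply: lerB; [apply: wM|apply: wm]; exact: mem_set.
have [k kp1] := dom_coverP A p1.
exists k, p1; split => //.
apply: (@lap_neq0_at_max u V c eps p1 k) => //.
have : \forall q \near p1, V q != 0.
  exact: (cvgr_neq0 _ (cV p1) Vp1).
move=> nV; near=> q; apply: psi1; apply: mem_set; apply: subset_closure.
by near: q.
Unshelve. all: by end_near. Qed.

End stability.

(** * Stability *)
Section positivity.
Context (R : realType) (m n : nat) (M : topologicalType) (A : smooth_atlas R m M).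
Context (g : nat -> metric_field R m) (C : nat -> connection R m).
Context (stat : statistical A g C) (e : nat -> 'I_m -> vfield R m)
  (oe : forall k, orthonormal_frame_on (img A k) (g k) (e k)).
Context (h : metric_field R n) (hE : euclidean_metric h).
Context (u V : M -> 'rV[R]_n) (su : smooth_map A u) (sV : smooth_map A V).

Let W := lap A C e u V.

Definition energy k x : R := ip (h (u (param A k x))) (W k x) (W k x).

Definition density k x : R := energy k x * Num.sqrt (\det (g k x)).

Lemma ip_ge0 y v : 0 <= ip (h y) v v.
Proof.
have [->|v0] := eqVneq v 0; first by rewrite /ip !mul0mx mxE.
have [[_ hpos] _] := hE; have [_ pos] := hpos y I.
by rewrite ltW// pos.
Qed.

Lemma lap_continuous k x : img A k x -> {for x, continuous (W k)}.
Proof.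
move=> kx; have [st _] := stat; have [_ sC _ _] := st k.
have sVk : smooth_on (img A k) (V \o param A k) by exact: sV.
exact: (laplacian_continuous (@open_img _ _ _ A k) sVk sC (oe k).1 kx).
Qed.

Lemma density_continuous k x : img A k x -> {for x, continuous (density k)}.
Proof.
move=> kx; have [st _] := stat; have [[sg _] _ _ _] := st k.
have cW := lap_continuous kx.
have ch : h (u (param A k y)) @[y --> x] --> h (u (param A k x)).
  have [[sh _] _] := hE.
  have cu : (u \o param A k) y @[y --> x] --> u (param A k x).
    exact: (@su k [::] x kx).1.
  have chy : h y @[y --> u (param A k x)] --> h (u (param A k x)).
    exact: (sh [::] _ Logic.I).1.
  exact: (cvg_comp _ _ cu chy).
have c1 : ip (h (u (param A k y))) (W k y) (W k y) @[y --> x] -->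
    ip (h (u (param A k x))) (W k x) (W k x).
  exact: (cvg_coord (cvg_mulmx (cvg_mulmx cW ch) (cvg_trmx cW))).
have c2 : Num.sqrt (\det (g k y)) @[y --> x] --> Num.sqrt (\det (g k x)).
  have cd : \det (g k y) @[y --> x] --> \det (g k x) by exact: (cvg_det (sg [::] x kx).1).
  exact: (cvg_comp _ _ cd (@sqrt_continuous R _)).
exact: (cvgM c1 c2).
Qed.

(** The piece with a positive integral is that of the least k such that W is
    non-zero at a point of Omega in the k-th chart: a neighbour of this point in
    an earlier chart would contradict the choice of k, by [lap_chart]. *)
Lemma integral_mfd_energy_gt0 (Omega : set M) p k0 :
  open Omega -> Omega p -> dom A k0 p -> W k0 (chart A k0 p) != 0 ->
  (0 < integral_mfd A g Omega energy)%E.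
Proof.
move=> oO Op k0p Wp.
have density_ge0 k y : 0 <= density k y.
  by rewrite mulr_ge0 ?sqrtr_ge0//; exact: ip_ge0.
pose P k := `[< exists p, [/\ Omega p, dom A k p & W k (chart A k p) != 0] >].
have exP : exists k, P k by exists k0; apply/asboolP; exists p.
case: (ex_minnP exP) => k /asboolP[q [Oq kq Wq]] kmin.
set x := chart A k q; have kx : img A k x := mem_img kq.
pose I j := integral_rV (chart A j @` (Omega `&` seqDU (dom A) j)) (density j).
rewrite -[X in (_ < X)%E]/(\sum_(j <oo) I j)%E.
have I0 j : (0 <= I j)%E by apply: integral_rV_ge0 => y _; exact: density_ge0.
apply: (@lt_le_trans _ _ (I k)); last first.
  apply: (@le_trans _ _ (\sum_(0 <= i < k.+1) I i)%E); last exact: nneseries_lim_ge.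
  by rewrite big_nat_recr//= leeDr// sume_ge0.
apply: (@integral_rV_gt0 _ _ _ _ x) => //; last first.
- exact: density_continuous.
- apply: mulr_gt0.
    have [[_ hpos] _] := hE; have [_ pos] := hpos (u (param A k x)) Logic.I.
    exact: pos.
  by rewrite sqrtr_gt0; exact: frame_det_gt0 ((oe k).2 x kx).
have nW : \forall y \near x, W k y != 0.
  exact: (cvgr_neq0 _ (lap_continuous kx) Wq).
have nO : \forall y \near x, (img A k `&` param A k @^-1` Omega) y.
  apply: open_nbhs_nbhs; split; first exact: open_preimage.
  by split => //; rewrite /x /= chartK.
near=> y.
have Wy : W k y != 0 by near: y.
have [ky Oy] : (img A k `&` param A k @^-1` Omega) y by near: y.
exists (param A k y); last exact: paramK.
split => //; split; first exact: dom_param.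
rewrite -bigcup_mkord => -[j /= jk jy].
suff /kmin : P j by rewrite leqNgt jk.
apply/asboolP; exists (param A k y); split => //.
by rewrite /W -(lap_chart stat oe u sV (dom_param ky) jy) paramK.
Unshelve. all: by end_near. Qed.

End positivity.

Theorem theorem5p1 (R : realType) (m : nat) (M : topologicalType)
    (A : smooth_atlas R m M) (f xi : M -> 'rV[R]_(m.+1))
    (g : nat -> metric_field R m) (C : nat -> connection R m)
    (S : nat -> 'rV[R]_m -> 'M[R]_m) (g0 : metric_field R m.+1) :
  (2 <= m)%N ->
  orientable A ->
  statistical A g C ->
  locally_convex_improper_affine_sphere A f xi g C S ->
  euclidean_metric g0 ->
  stable_statistical_biharmonic A g C g0 flat f.
Proof.
move=> m2 _ stat sphere g0E.
have sf : smooth_map A f by case: sphere => -[[]].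
split.
  split=> // k e oek x kx.
  exact: (sphere_biharmonic stat sphere g0E oek kx).
move=> e oe Omega V [_ oO _] sV [cK KO] V0; cbv zeta.
have [k [p [kp Vp Wp]]] := exists_nonharmonic (ltnW m2) sphere oe f sV cK V0.
have Op : Omega p by apply: KO; exact: subset_closure.
have pos := integral_mfd_energy_gt0 stat oe g0E sf sV oO Op kp Wp.
have -> : (fun j x => ip (g0 ((f \o param A j) x))
      (jacobi_part (f \o param A j) (C j) g0 flat (e j) (V \o param A j) x)
      (jacobi_part (f \o param A j) (C j) g0 flat (e j) (V \o param A j) x)) =
    energy A C e g0 f V.
  by apply/funext => j; apply/funext => x; rewrite (jacobi_part_flat g0E).
have -> : (fun j x => ip (g0 ((f \o param A j) x))
      (curlyH (f \o param A j) (g j) (C j) g0 flat (e j) (V \o param A j) x)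
      ((V \o param A j) x)) =
    (fun _ _ => 0).
  apply/funext => j; apply/funext => x.
  by rewrite (curlyH_flat g0E) /ip !mul0mx mxE.
rewrite [X in (_ + X)%E](_ : _ = 0%E) ?adde0//.
rewrite /integral_mfd eseries0// => j _ _; rewrite /integral_rV.
by apply: integral0_eq => t _; rewrite mul0r.
Qed.
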